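(* Let $f\colon X\to X$ be a topologically exact $S$-unimodal map with non-recurrent flat critical point $c$ that is of polynomial order. If $\mu\in\mathcal M(f)$ is a post-critical measure, then $\mathscr{I}(\mu)=0$.
   Context: $X=[0,1]$, $\mathcal M$ is the space of Borel probability measures on $X$ with the weak topology, $\mathcal M(f)\subset\mathcal M$ the set of $f$-invariant ones. $\delta_x^n=\frac1n\sum_{i=0}^{n-1}\delta_{f^i(x)}$. A unimodal map is a $C^1$ map $f\colon X\to X$ whose critical set $\{x\in X\colon Df(x)=0\}$ consists of a single point $c\in(0,1)$ that is an extremum. An $S$-unimodal map is a unimodal map that is of class $C^3$ on $X\setminus\{c\}$ with negative Schwarzian derivative. $f$ is topologically exact if for every (nonempty) open $U\subset X$ there is $n\ge1$ with $f^n(U)=X$. The critical point $c$ is non-recurrent if $c\notin\omega(c)$, where $\omega(c)$ is the omega-limit set of $c$. A critical point is flat if all derivatives of $f$ vanish there; for a flat critical point $c$ it is always assumed that there is a $C^1$ function $\ell$ on $X\setminus\{c\}$ such that (i) $\ell(x)\to\infty$ and $|D\ell(x)|\to\infty$ as $x\to c$ (from both sides); (ii) there are $C^1$ diffeomorphisms $\xi,\eta$ of $\mathbb R$ with $\xi(c)=0=\eta(f(c))$ and $|\xi(x)|^{\ell(x)}=\eta(f(x))$ for all $x$ near $c$. The flat critical point $c$ is of polynomial order if there is a $C^1$ function $v$ on $X$ with $v(c)>0$ and $\ell(x)=|x-c|^{-v(x)}$ for all $x$ near $c$. For $\nu\in\mathcal M(f)$, $h(\nu)$ is the Kolmogorov–Sinai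 entropy and $\chi(\nu)=\int\log|Df|\,d\nu$. Define $\mathscr{F}\colon\mathcal M\to[-\infty,0]$ by $\mathscr{F}(\nu)=h(\nu)-\chi(\nu)$ if $\nu\in\mathcal M(f)$ and $\mathscr{F}(\nu)=-\infty$ otherwise, and $\mathscr{I}(\mu)=-\inf_{\mathcal G\ni\mu}\sup_{\nu\in\mathcal G}\mathscr{F}(\nu)$, the infimum being over all open subsets $\mathcal G$ of $\mathcal M$ containing $\mu$. A measure $\mu\in\mathcal M$ is a post-critical measure if there is an increasing sequence $\{m_i\}_{i\ge0}$ of positive integers such that $\delta_c^{m_i}$ converges weakly to $\mu$ as $i\to\infty$. *)

(* Defs.v *)
From HB Require Import structures.
From mathcomp Require Import all_boot all_order all_algebra.
From mathcomp Require Import all_classical all_reals all_analysis.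

Set Implicit Arguments.
Unset Strict Implicit.
Unset Printing Implicit Defensive.

Import Order.TTheory GRing.Theory Num.Theory.
Import numFieldNormedType.Exports.

Local Open Scope classical_set_scope.
Local Open Scope ring_scope.

(* [X R] is the unit interval as a space in its own right: it carries the
   topology induced from R and the Borel sigma-algebra of that topology. *)
Definition X (R : realType) : Type := set_type (`[0, 1]%classic : set R).

Section unit_interval_structures.
Variable R : realType.

Lemma X0_subproof : (0 : R) \in (`[0, 1]%classic : set R).
Proof. by apply/mem_set; rewrite /= in_itv /= lexx ler01. Qed.

HB.instance Definition _ :=
  PseudoMetric.copy (X R) (set_type (`[0, 1]%classic : set R)).
HB.instance Definition _ :=
  isPointed.Build (X R) (exist _ (0 : R) X0_subproof).
HB.instance Definition _ :=
  Measurable.copy (X R) (g_sigma_algebraType (@open (X R))).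

End unit_interval_structures.

Definition toR (R : realType) (x : X R) : R := set_val x.
Arguments toR {R} x.

(* Differentiation of functions on [X R]. The limit is taken inside [X R], so
   that derivatives at the endpoints 0 and 1 are one-sided. *)
Section derivatives.
Variable R : realType.
Implicit Types (g : X R -> R) (x : X R) (U : set (X R)).

Definition diff_quotient g x : X R -> R :=
  fun y => (g y - g x) / (toR y - toR x).

Definition differentiable_at g x : Prop :=
  cvg (diff_quotient g x y @[y --> x^']).

Definition D g : X R -> R := fun x => lim (diff_quotient g x y @[y --> x^']).

(* Meant for sets [U] that are open in [X R]. *)
Definition class_C n U g : Prop :=
  (forall k x, (k < n)%N -> U x -> differentiable_at (iter k D g) x) /\
  (forall x, U x -> {for x, continuous (iter n D g)}).

(* Existence of the derivative of order [n] at the point [x], which presupposes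
   that of the derivative of order [n.-1] near [x]. *)
Fixpoint n_differentiable_at n g x : Prop :=
  if n is m.+1 then
    (\forall y \near x, n_differentiable_at m g y) /\
    differentiable_at (iter m D g) x
  else True.

Definition schwarzian g x : R :=
  iter 3 D g x / D g x - 3 / 2 * (iter 2 D g x / D g x) ^+ 2.

End derivatives.
Arguments D {R} g x.

Section interval_maps.
Variable R : realType.
Implicit Types (f : X R -> X R) (c : X R) (ell : X R -> R).

Definition unimodal f c : Prop :=
  [/\ class_C 1 setT (toR \o f),
      0 < toR c < 1,
      [set x | D (toR \o f) x = 0] = [set c] &
      (\forall x \near c, toR (f x) <= toR (f c)) \/
      (\forall x \near c, toR (f c) <= toR (f x))].

Definition S_unimodal f c : Prop :=
  [/\ unimodal f c,
      class_C 3 (~` [set c]) (toR \o f) &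
      forall x, x != c -> schwarzian (toR \o f) x < 0].

Definition topologically_exact f : Prop :=
  forall U : set (X R), open U -> U !=set0 ->
    exists2 n, (0 < n)%N & iter n f @` U = setT.

Definition omega_limit f (x : X R) : set (X R) :=
  cluster (iter n f x @[n --> \oo]).

Definition non_recurrent f c : Prop := ~ omega_limit f c c.

Definition C1_line (g : R -> R) : Prop :=
  (forall t, derivable g t 1) /\ continuous (derive1 g).

Definition C1_diffeo_line (g : R -> R) : Prop :=
  C1_line g /\
  exists h : R -> R, [/\ C1_line h, cancel g h & cancel h g].

Definition flat f c : Prop :=
  forall n, (0 < n)%N ->
    n_differentiable_at n (toR \o f) c /\ iter n D (toR \o f) c = 0.

(* The standing assumption on a flat critical point [c]; the value [ell c] is
   irrelevant. *)
Definition flat_exponent f c ell : Prop :=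
  [/\ class_C 1 (~` [set c]) ell,
      ell x @[x --> c^'] --> +oo,
      `|D ell x| @[x --> c^'] --> +oo &
      exists xi eta : R -> R,
        [/\ C1_diffeo_line xi, C1_diffeo_line eta,
            xi (toR c) = 0, eta (toR (f c)) = 0 &
            \forall x \near c^',
              `|xi (toR x)| `^ (ell x) = eta (toR (f x))]].

Definition polynomial_order c ell : Prop :=
  exists v : X R -> R,
    [/\ class_C 1 setT v, 0 < v c &
        \forall x \near c^', ell x = `|toR x - toR c| `^ (- v x)].

End interval_maps.

(* The weak topology: the coarsest one making all [mu |-> \int phi d mu], with
   [phi] continuous, continuous. *)
Definition integrals (R : realType) (mu : probability (X R) R) :
    {ptws continuousType (X R) R -> R} :=
  fun phi => \int[mu]_x phi x.

Notation M R := (initial_topology (@integrals R)).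

Section invariant_measures.
Variables (R : realType) (f : X R -> X R).
Implicit Types (mu nu : M R).

Definition invariant_measure nu : Prop :=
  forall A : set (X R), measurable A ->
    (nu : probability _ _) (f @^-1` A) = (nu : probability _ _) A.

(* The measure $\delta_x^n$ for [n > 0]; see [empiricalE]. *)
Definition empirical (x : X R) n : M R :=
  mnormalize (msum (fun i => \d_(iter i f x)) n) \d_x : probability (X R) R.

Lemma empiricalE (x : X R) n (A : set (X R)) : (0 < n)%N ->
  (empirical x n : probability _ _) A =
  ((n%:R^-1)%:E * \sum_(i < n) \d_(iter i f x) A)%E.
Proof.
move=> n0.
have mT : msum (fun i => \d_(iter i f x)) n [set: X R] = (n%:R : R)%:E.
  rewrite /msum /=; under eq_bigr do rewrite diracT.
  by rewrite sumEFin sumr_const card_ord.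
rewrite /empirical /= /mnormalize /=.
by rewrite mT eqe pnatr_eq0 -leqn0 leqNgt n0 /= muleC.
Qed.

Definition post_critical (c : X R) mu : Prop :=
  exists m : nat -> nat,
    [/\ {homo m : i j / (i < j)%N},
        forall i, (0 < m i)%N &
        empirical c (m i) @[i --> \oo] --> mu].

(* A finite Borel partition is given by its labelling map [xi : X R -> 'I_k].
   The atoms of its [n]-th refinement under [f] are indexed by words [w]. *)
Definition atom k (xi : X R -> 'I_k) n (w : {ffun 'I_n -> 'I_k}) : set (X R) :=
  [set x | forall i : 'I_n, xi (iter i f x) = w i].

(* [ln 0 = 0], so that null atoms contribute 0. *)
Definition refinement_entropy nu k (xi : X R -> 'I_k) n : R :=
  - \sum_(w : {ffun 'I_n -> 'I_k})
      let p := fine ((nu : probability _ _) (atom xi w)) in p * ln p.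

Definition partition_entropy nu k (xi : X R -> 'I_k) : \bar R :=
  limn (fun n => (refinement_entropy nu xi n / n%:R)%:E).

Definition entropy nu : \bar R :=
  ereal_sup [set e | exists k (xi : X R -> 'I_k),
    (forall i, measurable (xi @^-1` [set i])) /\ e = partition_entropy nu xi].

(* [lne 0 = -oo], and the integral may be -oo. *)
Definition lyapunov nu : \bar R :=
  (\int[(nu : probability _ _)]_x lne `|D (toR \o f) x|%:E)%E.

Definition free_energy nu : \bar R :=
  if `[< invariant_measure nu >] then (entropy nu - lyapunov nu)%E else -oo%E.

Definition rate mu : \bar R :=
  (- ereal_inf [set ereal_sup (free_energy @` G)
                 | G in [set G : set (M R) | open G /\ G mu]])%E.

End invariant_measures.

(* Main.v *)
Require Import Defs.
From mathcomp Require Import all_boot all_order all_algebra.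
From mathcomp Require Import all_classical all_reals all_analysis.
From mathcomp Require Import measurable_realfun ring lra zify.

Set Implicit Arguments.
Unset Strict Implicit.
Unset Printing Implicit Defensive.

Import Order.TTheory GRing.Theory Num.Theory.
Import numFieldNormedType.Exports.

Local Open Scope classical_set_scope.
Local Open Scope ring_scope.

(** The rate vanishes because of two facts about the free energy
    F(nu) = h(nu) - chi(nu) of invariant measures: it is never positive, and every
    neighbourhood of a post-critical measure contains invariant measures whose
    free energy is as close to 0 as desired. Both rest on one consequence of
    topological exactness ([exact_spread]): once an iterate has stretched an
    interval to length e, a bounded number N(e) of further steps maps it onto X.

    Upper bound ([ruelle_inequality]). The largest interval [x, y] that stays
    e-small along n steps is stretched to length e at some time, so N(e) steps
    after time n its image is X. If psi is a continuous majorant of log |Df|, the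
    mean value theorem then bounds the length of this Bowen interval from below
    by a constant times exp(- S_n psi(x) - n d) ([bowen_volume]). Given a
    finite Borel partition, continuous functions that predict the label of a
    point at small average logarithmic cost ([partition_of_unity]) turn
    Lebesgue measure into a probability on words of length n; the weight of the
    word of x is at least the length of its Bowen interval, up to the prediction
    cost. The Gibbs inequality then gives h <= int psi + d for this partition
    ([refinement_entropy_le]). Letting psi = log max(|Df|, exp(- K)) decrease to
    log |Df| yields h <= chi, even where log |Df| is not bounded below.

    Lower bound ([slow_periodic_orbits]). The Bowen interval of c for m steps is
    mapped onto X at time m + N, so it contains a periodic point p of period
    m + N, whose orbit shadows the first m points of the orbit of c, with an
    error that is small except during the last few steps. Hence the periodic
    measures have the same weak limits as the measures delta_c^m. As
    the critical orbit stays away from c, log |Df| is uniformly continuous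
    along it, and sum_(1 <= i < m) log |Df(f^i p)| differs by o(m) from the
    logarithm of |f^m p - f^m c| / |f p - f c|, hence is at most
    - log |f p - f c| + o(m). The remaining term log |Df(p)| cancels this up to the
    logarithm of |Df(p)| / |f p - f c|, which flatness of polynomial order
    makes a power of 1 / |p - c|, while - log |f p - f c|, which is at most of order
    m, exceeds a power of 1 / |p - c| ([flat_derivative]). So
    the exponent of the periodic measure is o(1); its entropy is nonnegative, and
    its free energy tends to 0. *)

(** * The unit interval and its coordinate *)

Section unit_interval.
Variable R : realType.
Implicit Types (x y s t : X R) (r : R).

Lemma toR_itv x : 0 <= toR x <= 1.
Proof. by have := set_valP x; rewrite /= in_itv. Qed.

Lemma toR_dist_le1 x y : `|toR x - toR y| <= 1.
Proof. by rewrite ler_norml; have := toR_itv x; have := toR_itv y; lra. Qed.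

Lemma toR_inj : injective (@toR R).
Proof. by move=> x y; rewrite /toR set_valE => /val_inj. Qed.

Definition clip r : R := Num.max 0 (Num.min 1 r).

Lemma clip_subproof r : clip r \in (`[0, 1]%classic : set R).
Proof.
by apply/mem_set; rewrite /= in_itv /= /clip le_max lexx ge_max ler01 ge_min lexx.
Qed.

(** A continuous retraction of the line onto the interval: it carries functions
    on [X R] to functions on the line, where the classical calculus applies. *)
Definition to_X r : X R := exist _ (clip r) (clip_subproof r).

Lemma toR_to_X r : toR (to_X r) = clip r.
Proof. by rewrite /toR set_valE. Qed.

Lemma to_XK r : 0 <= r <= 1 -> toR (to_X r) = r.
Proof. by move=> /andP[r0 r1]; rewrite toR_to_X /clip min_r// max_r. Qed.

Lemma toRK x : to_X (toR x) = x.
Proof. by apply: toR_inj; rewrite to_XK// toR_itv. Qed.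

Lemma clip_lip r1 r2 : `|clip r1 - clip r2| <= `|r1 - r2|.
Proof.
rewrite /clip /Num.max /Num.min; do ! case: ifPn => //; rewrite -?leNgt.
all: rewrite ?ltr01 ?ltxx// => *; rewrite ler_norml; have := ler_norm (r1 - r2);
  have := ler_norm (r2 - r1); rewrite (distrC r2); lra.
Qed.

Lemma nbhs_toRP x (A : set (X R)) :
  nbhs x A <-> exists2 e, 0 < e & forall y, `|toR x - toR y| < e -> A y.
Proof.
split=> [/nbhs_ballP[e /= e0 xA]|[e e0 xA]].
  by exists e => // y xy; apply: xA.
by apply/nbhs_ballP; exists e.
Qed.

Lemma toR_continuous : continuous (@toR R).
Proof.
move=> x A /nbhs_ballP[e /= e0 xA].
by apply/nbhs_toRP; exists e => // y xy; apply: xA.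
Qed.

Lemma to_X_continuous : continuous to_X.
Proof.
move=> r A /nbhs_toRP[e /= e0 xA].
apply/nbhs_ballP; exists e => // y xy; apply: xA.
by rewrite !toR_to_X; apply: le_lt_trans xy; apply: clip_lip.
Qed.

Lemma X_compact : compact [set: X R].
Proof.
have -> : [set: X R] = to_X @` `[0, 1].
  apply/seteqP; split => // x _; exists (toR x); last exact: toRK.
  by rewrite /= in_itv; apply: toR_itv.
apply: continuous_compact; last exact: segment_compact.
by apply: continuous_subspaceT; apply: to_X_continuous.
Qed.

(** Heine's theorem, from the compactness of [X R] in its near-covering form. *)
Lemma X_unif_continuous (g : X R -> R) : continuous g ->
  forall e, 0 < e -> exists2 d, 0 < d &
    forall x y, `|toR x - toR y| <= d -> `|g x - g y| <= e.
Proof.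
move=> gc e e0.
have /compact_near_coveringP X_cover := X_compact.
have := X_cover _ (0^'+ : set_system R)
  (fun d x => forall y, `|toR x - toR y| <= d -> `|g x - g y| <= e) _.
case.
  move=> x _; have e20 : 0 < e / 2 by rewrite divr_gt0.
  have /nbhs_toRP[d d0 xd] : \forall y \near x, `|g x - g y| < e / 2.
    have /cvgrPdist_lt := gc x; exact.
  exists ([set y | `|toR x - toR y| < d / 2], [set r | r < d / 2]) => /=.
    split; last by apply: nbhs_right_lt; rewrite divr_gt0.
    by apply/nbhs_toRP; exists (d / 2) => //; rewrite divr_gt0.
  move=> [y r] /= [xy rd] z yz.
  have gy : `|g x - g y| < e / 2 by apply: xd; apply: (lt_trans xy); lra.
  have gz : `|g x - g z| < e / 2.
    apply: xd; apply: le_lt_trans (ler_distD (toR y) _ _) _; lra.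
  apply: le_trans (ler_distD (g x) _ _) _; rewrite (distrC (g y)); lra.
move=> d /= d0 hd; exists (d / 2); first by rewrite divr_gt0.
move=> x y xy; have /= := hd (d / 2); apply => //; last by rewrite divr_gt0.
by rewrite /= sub0r normrN gtr0_norm ?divr_gt0// ltr_pdivrMr// ltr_pMr// ltr1n.
Qed.

Lemma X_bounded (g : X R -> R) : continuous g ->
  exists2 B, 0 < B & forall x, `|g x| <= B.
Proof.
move=> gc.
have /compact_bounded[M [Mr MB]] : compact (g @` setT).
  by apply: continuous_compact X_compact; apply: continuous_subspaceT.
exists (`|M| + 1) => [|x]; first by rewrite ltr_wpDl.
apply: MB; last by exists x.
by rewrite (le_lt_trans (ler_norm M))// ltrDl.
Qed.

End unit_interval.

(** * Intermediate values on the unit interval *)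

Section between.
Variable R : realType.
Implicit Types (x y s t z : X R).

(** Intervals with unordered endpoints: the images of an interval under iterates
    of [f] carry no orientation. *)
Definition between x y s :=
  Num.min (toR x) (toR y) <= toR s <= Num.max (toR x) (toR y).

Lemma between_cases x y s : between x y s ->
  toR x <= toR s <= toR y \/ toR y <= toR s <= toR x.
Proof.
by rewrite /between; case: (leP (toR x) (toR y)) => _; [left|right].
Qed.

Lemma betweenl x y : between x y x.
Proof. by rewrite /between ge_min le_max lexx. Qed.

Lemma betweenr x y : between x y y.
Proof. by rewrite /between ge_min le_max lexx !orbT. Qed.

Lemma betweenC x y s : between x y s = between y x s.
Proof. by rewrite /between minC maxC. Qed.

Lemma between_le x y s : toR x <= toR s -> toR s <= toR y -> between x y s.
Proof. by move=> xs sy; rewrite /between ge_min xs le_max sy orbT. Qed.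

Lemma between_dist x y s t : between x y s -> between x y t ->
  `|toR s - toR t| <= `|toR x - toR y|.
Proof.
have := ler_norm (toR x - toR y); have := ler_norm (toR y - toR x).
rewrite (distrC (toR y)) => ? ? /between_cases ? /between_cases ?.
rewrite ler_norml; lra.
Qed.

Lemma between_trans x y s t : between x y s -> between x s t -> between x y t.
Proof.
move=> /between_cases ? /between_cases ?.
have [xy|/ltW xy] := leP (toR x) (toR y); last rewrite betweenC.
  by apply: between_le; lra.
by apply: between_le; lra.
Qed.

Lemma between_sub x y s t z : between x y s -> between x y t ->
  between s t z -> between x y z.
Proof.
move=> /between_cases ? /between_cases ? /between_cases ?.
have [xy|/ltW xy] := leP (toR x) (toR y); last rewrite betweenC.
  by apply: between_le; lra.
by apply: between_le; lra.
Qed.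

Lemma continuous_comp_to_X (g : X R -> R) : continuous g ->
  continuous (g \o @to_X R).
Proof. by move=> gc r; apply: continuous_comp; [exact: to_X_continuous|exact: gc]. Qed.

Lemma X_IVT (g : X R -> R) x y v : continuous g ->
  Num.min (g x) (g y) <= v <= Num.max (g x) (g y) ->
  exists2 s, between x y s & g s = v.
Proof.
move=> gc; wlog xy : x y / toR x <= toR y.
  move=> hw; have [|/ltW yx] := leP (toR x) (toR y); first exact: hw.
  by rewrite minC maxC => /(hw _ _ yx)[s]; rewrite betweenC; exists s.
move=> gv; have [//| |r] := @IVT _ (g \o @to_X R) (toR x) (toR y) v xy.
- by apply: continuous_subspaceT; apply: continuous_comp_to_X.
- by rewrite /= !toRK.
rewrite in_itv /= => /andP[xr ry] gr.
have := toR_itv x; have := toR_itv y => /andP[_ y1] /andP[x0 _].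
have rK : toR (to_X r) = r by apply: to_XK; lra.
by exists (to_X r) => //; apply: between_le; rewrite rK.
Qed.

Lemma X_map_IVT (g : X R -> X R) x y z : continuous g ->
  between (g x) (g y) z -> exists2 s, between x y s & g s = z.
Proof.
move=> gc /(@X_IVT (@toR R \o g)) [r|s xys /toR_inj ?]; last by exists s.
by apply: continuous_comp; [exact: gc|exact: toR_continuous].
Qed.

Lemma continuous_iter (f : X R -> X R) n : continuous f -> continuous (iter n f).
Proof.
move=> fc; elim: n => [|n IHn] x; first exact: cvg_id.
by apply: (@continuous_comp _ _ _ (iter n f) f); [exact: IHn|exact: fc].
Qed.

(** The crossing point is the infimum of the superlevel set: the level is at least
    [e] there by continuity, and it is at most [e] because an intermediate value
    before it would contradict minimality. The segment from [x] to [z] is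
    parametrized by [0, 1] so that both orientations are treated at once. *)
Lemma first_crossing (g : X R -> R) x z (e : R) : continuous g ->
  g x <= e -> e <= g z ->
  exists y, [/\ between x z y, g y = e & forall s, between x y s -> g s <= e].
Proof.
move=> gc gx gz.
pose seg (t : R) := toR x + t * (toR z - toR x).
pose h := g \o @to_X R \o seg.
have seg01 (t : R) : 0 <= t <= 1 -> between x z (to_X (seg t)) /\ toR (to_X (seg t)) = seg t.
  have := toR_itv x; have := toR_itv z => /andP[z0 z1] /andP[x0 x1] /andP[t0 t1].
  have segK : toR (to_X (seg t)) = seg t by apply: to_XK; rewrite /seg; nra.
  split=> //; rewrite /between segK /seg.
  by case: (leP (toR x) (toR z)) => xz; nra.
have hc : continuous h.
  move=> t; apply: (@continuous_comp _ _ _ seg).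
    by apply: cvgD; [exact: cvg_cst|apply: cvgMl; exact: cvg_id].
  exact: continuous_comp_to_X.
pose S := [set t : R | 0 <= t <= 1 /\ e <= h t].
have hS : has_inf S.
  split; last by exists 0 => t [/andP[]].
  exists 1; split; first by rewrite lexx ler01.
  by rewrite /h /= /seg mul1r addrCA subrr addr0 toRK.
pose t0 := inf S.
have t00 : 0 <= t0 by apply: lb_le_inf; [exact: hS.1|move=> t [/andP[]]].
have St0 (t : R) : S t -> t0 <= t by move=> St; apply: ge_inf => //; exact: hS.2.
have t01 : t0 <= 1.
  apply: St0; split; first by rewrite lexx ler01.
  by rewrite /h /= /seg mul1r addrCA subrr addr0 toRK.
have h0 : h 0 <= e by rewrite /h /= /seg mul0r addr0 toRK.
have ht0 : h t0 = e.
  apply/eqP; rewrite eq_le; apply/andP; split.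
    rewrite leNgt; apply/negP => et0.
    have [//| |u] := @IVT _ h 0 t0 e t00.
    - exact: continuous_subspaceT.
    - by rewrite ge_min h0 le_max (ltW et0) orbT.
    rewrite in_itv /= => /andP[u0 ut0] hu.
    have : t0 <= u by apply: St0; split; rewrite ?hu// u0 (le_trans ut0).
    by move=> t0u; move: et0; rewrite (_ : t0 = u) ?hu ?ltxx//; apply/eqP; rewrite eq_le t0u.
  rewrite leNgt; apply/negP => et0.
  have e0 : 0 < e - h t0 by rewrite subr_gt0.
  have /cvgrPdist_lt /(_ _ e0) /nbhs_ballP[d /= d0 hd] := hc t0.
  have [t St tt0] := inf_adherent d0 hS.
  have t0t := St0 _ St; have et := St.2; rewrite -/t0 in tt0.
  have : `|h t0 - h t| < e - h t0.
    by apply: hd; rewrite /ball /= ler0_norm ?subr_le0//; lra.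
  by have := ler_norm (h t - h t0); rewrite distrC; lra.
have t001 : 0 <= t0 <= 1 by rewrite t00.
have [xzy yE] := seg01 _ t001.
exists (to_X (seg t0)); split => // s /between_cases; rewrite yE => xys.
have [xz|xz] := eqVneq (toR x) (toR z).
  have -> : s = x; last by [].
  by apply: toR_inj; move: xys; rewrite /seg xz subrr mulr0 addr0; lra.
pose u := (toR s - toR x) / (toR z - toR x).
have zx0 : toR z - toR x != 0 by rewrite subr_eq0 eq_sym.
have su : seg u = toR s by rewrite /seg /u divfK// addrC subrK.
have -> : g s = h u by rewrite /h /= su toRK.
have [u0 ut0] : 0 <= u /\ u <= t0.
  move: zx0; rewrite neq_lt => /orP[zx|zx].
    rewrite /u ler_ndivlMr// mul0r ler_ndivrMr//.
    by move: xys; rewrite /seg; case; nra.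
  rewrite /u ler_pdivlMr// mul0r ler_pdivrMr//.
  by move: xys; rewrite /seg; case; nra.
have [ut|] := ltP u t0; last by move=> tu; rewrite (_ : u = t0) ?ht0//; lra.
rewrite leNgt; apply/negP => /ltW eu.
have : t0 <= u by apply: St0; split=> //; rewrite u0; lra.
by rewrite leNgt ut.
Qed.

End between.

(** * Topological exactness and Bowen intervals *)

Section exactness.
Variables (R : realType) (f : X R -> X R).
Hypothesis fc : continuous f.
Hypothesis fexact : topologically_exact f.
Implicit Types x y s z : X R.

Lemma exact_surjective n z : exists x, iter n f x = z.
Proof.
elim: n z => [|n IHn] z; first by exists z.
have [|[//|m] _ fm] := fexact (@openT (X R)); first by exists point.
have [w _ <-] : (iter m.+1 f @` setT) z by rewrite fm.
by have [x wE] := IHn (iter m f w); exists x; rewrite !iterS wE.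
Qed.

(** Finitely many test intervals suffice: every interval of length [e] contains
    one of the intervals ]k/K, (k+1)/K[ as soon as 2/K <= e. *)
Lemma exact_uniform (e : R) : 0 < e -> exists N, forall x y, e <= `|toR x - toR y| ->
  forall n, (N <= n)%N -> forall z, exists2 s, between x y s & iter n f s = z.
Proof.
move=> e0; pose K := (Num.truncn (2 / e)).+1.
have Ke : 2 <= K%:R * e by rewrite -ler_pdivrMr// ltW// truncnS_gt.
have K0 : 0 < K%:R :> R by rewrite ltr0n.
pose U (k : 'I_K) := [set w : X R | k%:R < K%:R * toR w < k%:R + 1].
have /choice[N UN] : forall k, exists n, iter n f @` U k = setT.
  move=> k.
  have [||n _ fn] := @fexact (U k); last by exists n.
    have -> : U k = (fun w => K%:R * toR w) @^-1` `]k%:R, k%:R + 1[.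
      by apply/seteqP; split=> w; rewrite /U /= in_itv.
    have cK : continuous (fun w : X R => K%:R * toR w : R).
      by move=> w; apply: (cvgMr (@toR_continuous R w)).
    by move/continuousP: cK; apply; exact: interval_open.
  have kK : k%:R + 1 <= K%:R :> R by rewrite natr1 ler_nat.
  have k0 : 0 <= k%:R :> R by [].
  exists (to_X ((k%:R + 2^-1) / K%:R)); rewrite /U /= to_XK.
    by rewrite mulrC divfK ?gt_eqF//; lra.
  by rewrite divr_ge0 ?ler_pdivrMr//; lra.
exists (\max_k N k)%N => x y; wlog xy : x y / toR x <= toR y.
  move=> hw; have [|/ltW yx] := leP (toR x) (toR y); first exact: hw.
  rewrite distrC => /(hw _ _ yx) h n Nn z; have [s xs <-] := h n Nn z.
  by exists s; rewrite // betweenC.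
rewrite distrC ger0_norm ?subr_ge0// => exy n Nn z.
have /andP[x0 x1] := toR_itv x; have /andP[y0 y1] := toR_itv y.
pose k := (Num.truncn (K%:R * toR x)).+1.
have kx : K%:R * toR x < k%:R by rewrite truncnS_gt.
have xk : k%:R <= K%:R * toR x + 1.
  by rewrite -natr1 lerD2r truncn_le mulr_ge0// ltW.
have ky : k%:R + 1 <= K%:R * toR y by nra.
have kK : (k < K)%N by rewrite -(ltr_nat R) -(ltrD2r 1); nra.
pose k' := Ordinal kK.
have Nk : (N k' <= n)%N by apply: leq_trans Nn; exact: leq_bigmax.
have [z' <-] := exact_surjective (n - N k') z.
have [w /= /andP[kw wk] <-] : (iter (N k') f @` U k') z' by rewrite UN.
exists w; last by rewrite -iterD subnK.
by apply: between_le; rewrite -(ler_pM2l K0); lra.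
Qed.

(** By the intermediate value theorem the j-th image contains an interval of
    length [e], which N steps spread over X; the image then stays equal to X. *)
Lemma exact_spread (e : R) : 0 < e -> exists N, forall j x y,
  e <= `|toR (iter j f x) - toR (iter j f y)| ->
  forall n, (j + N <= n)%N -> forall z,
  exists2 s, between x y s & iter n f s = z.
Proof.
move=> /exact_uniform[N HN]; exists N => j x y /HN h n jNn z.
have jn : (j <= n)%N by apply: leq_trans jNn; rewrite leq_addr.
have [|u xyu uz] := h (n - j)%N _ z; first by rewrite leq_subRL.
have [s xys su] := X_map_IVT (@continuous_iter _ _ j fc) xyu.
by exists s; rewrite // -(subnK jn) iterD su.
Qed.

End exactness.

Section bowen.
Variables (R : realType) (f : X R -> X R).
Hypothesis fc : continuous f.
Implicit Types x y s z : X R.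

(** The dynamical distance, max over i <= n of |f^i x - f^i y|. *)
Fixpoint bowen_dist n x y : R :=
  if n is m.+1 then Num.max `|toR x - toR y| (bowen_dist m (f x) (f y))
  else `|toR x - toR y|.

Lemma bowen_dist_ge n x y i : (i <= n)%N ->
  `|toR (iter i f x) - toR (iter i f y)| <= bowen_dist n x y.
Proof.
elim: n x y i => [|n IHn] x y [|i] //= => [_|]; first by rewrite le_max lexx.
by rewrite ltnS => /(IHn (f x) (f y)); rewrite -!iterSr /= le_max => ->; rewrite orbT.
Qed.

Lemma bowen_dist_attained n x y : exists2 i, (i <= n)%N &
  bowen_dist n x y = `|toR (iter i f x) - toR (iter i f y)|.
Proof.
elim: n x y => [|n IHn] x y /=; first by exists 0%N.
have [i ni ->] := IHn (f x) (f y).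
case: leP => _; last by exists 0%N.
by exists i.+1; rewrite // !iterSr.
Qed.

Lemma bowen_dist_refl n x : bowen_dist n x x = 0.
Proof. by have [i _ ->] := bowen_dist_attained n x x; rewrite subrr normr0. Qed.

Lemma bowen_dist_continuous n x : continuous (bowen_dist n x).
Proof.
have dc z : continuous (fun y => `|toR z - toR y|).
  by move=> y; apply: (cvg_norm (cvgB (cvg_cst _) (@toR_continuous R y))).
elim: n x => [|n IHn] x /=; first exact: dc.
move=> y; apply: (@continuous_max _ _ (fun y => `|toR x - toR y|)
  (fun y => bowen_dist n (f x) (f y))).
  exact: dc.
by apply: (@continuous_comp _ _ _ f); [exact: fc|exact: IHn].
Qed.

(** A Bowen interval is cut off where some iterate has grown to length [e]; this
    is what [exact_spread] exploits. *)
Lemma bowen_interval n (e : R) x z : 0 <= e -> e <= `|toR x - toR z| ->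
  exists y, [/\ between x z y,
    forall s, between x y s -> forall i, (i <= n)%N ->
      `|toR (iter i f x) - toR (iter i f s)| <= e &
    exists2 i, (i <= n)%N & `|toR (iter i f x) - toR (iter i f y)| = e].
Proof.
move=> e0 xz; have [||y [xzy yE ys]] :=
  @first_crossing _ (bowen_dist n x) x z e (bowen_dist_continuous (x := x)).
- by rewrite bowen_dist_refl.
- by apply: le_trans xz _; apply: (@bowen_dist_ge n x z 0).
exists y; split=> // [s xys i ni|].
  exact: le_trans (bowen_dist_ge x s ni) (ys s xys).
by have [i ni E] := bowen_dist_attained n x y; exists i; rewrite // -E.
Qed.

End bowen.

(** * Differential calculus on the unit interval *)

Section calculus.
Variable R : realType.
Implicit Types (g : X R -> R) (x y s t z : X R) (r : R).

Lemma continuous_toRP g x :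
  (forall e : R, 0 < e -> exists2 d : R, 0 < d &
     forall y, `|toR x - toR y| < d -> `|g x - g y| < e) ->
  {for x, continuous g}.
Proof.
move=> h.
apply: (@cvgrPdist_lt _ _ _ (nbhs x) (nbhs_filter x) g (g x)).2 => e /h[d d0 hd].
by apply/nbhs_toRP; exists d.
Qed.

Lemma D_limit g x : differentiable_at g x -> forall e : R, 0 < e ->
  exists2 d : R, 0 < d & forall y, y != x -> `|toR x - toR y| < d ->
  `|D g x - diff_quotient g x y| < e.
Proof.
move=> gx e e0; have /cvgrPdist_lt/(_ _ e0) : diff_quotient g x y @[y --> x^'] --> D g x.
  exact: gx.
move=> /nbhs_toRP[d d0 hd]; exists d => // y yx xy.
by apply: hd.
Qed.

Lemma differentiable_at_continuous g x : differentiable_at g x -> {for x, continuous g}.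
Proof.
move=> /D_limit/(_ 1 ltr01)[d d0 hd].
apply: continuous_toRP => e e0.
pose C := `|D g x| + 1; have C0 : 0 < C by rewrite ltr_wpDl.
exists (Num.min d (e / C)).
  by rewrite lt_min d0 divr_gt0.
move=> y; rewrite lt_min => /andP[xyd xye].
have [->|yx] := eqVneq y x; first by rewrite subrr normr0.
have := hd y yx xyd; rewrite /diff_quotient => hq.
have yx0 : toR y - toR x != 0.
  by rewrite subr_eq0; apply: contra_neq yx; exact: toR_inj.
have -> : g x - g y = (g y - g x) / (toR y - toR x) * (toR x - toR y).
  by rewrite -[toR x - toR y]opprB mulrN divfK// opprB.
rewrite normrM; move: xye; rewrite ltr_pdivlMr// => xye.
apply: le_lt_trans xye; rewrite mulrC ler_wpM2l//.
have := ler_normB (D g x) (D g x - (g y - g x) / (toR y - toR x)).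
by rewrite opprB addrCA subrr addr0 /C => /le_trans; apply; rewrite lerD2l ltW.
Qed.

Lemma is_derive_to_X g r : 0 < r < 1 -> differentiable_at g (to_X r) ->
  is_derive r 1 (g \o @to_X R) (D g (to_X r)).
Proof.
move=> /andP[r0 r1] /D_limit gr.
have cv : h^-1 *: (((g \o @to_X R) \o shift r) (h *: (1 : R)) - (g \o @to_X R) r)
    @[h --> 0^'] --> D g (to_X r).
  apply/cvgrPdist_lt => e e0; have [d d0 hd] := gr e e0.
  have [m [m0 md mr mr1]] : exists m : R, [/\ 0 < m, m <= d, m <= r & m <= 1 - r].
    exists (Num.min d (Num.min r (1 - r))).
    by split; rewrite ?lt_min ?d0 ?r0 ?subr_gt0// !ge_min lexx ?orbT.
  apply/nbhs_ballP; exists m => // h; rewrite /ball /= sub0r normrN => hm h0.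
  have /andP[hm1 hm2] : - m < h < m by rewrite -ltr_norml.
  have rK : toR (to_X r) = r by apply: to_XK; lra.
  have hK : toR (to_X (h + r)) = h + r by apply: to_XK; lra.
  have hr : `|toR (to_X r) - toR (to_X (h + r))| = `|h|.
    by rewrite rK hK opprD addrCA subrr addr0 normrN.
  have /hd : to_X (h + r) != to_X r.
    apply: contra_neq h0 => /(congr1 (@toR R)); rewrite rK hK => /eqP.
    by rewrite -subr_eq0 addrK => /eqP.
  rewrite hr => /(_ (lt_le_trans hm md)); rewrite /diff_quotient rK hK addrK.
  by rewrite /= [h *: 1]mulr1 [h^-1 *: _]mulrC.
by apply: DeriveDef; [apply/cvg_ex; exists (D g (to_X r))|exact: cvg_lim cv].
Qed.

Lemma X_MVT g s t : (forall x, differentiable_at g x) ->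
  exists2 z, between s t z & g t - g s = D g z * (toR t - toR s).
Proof.
move=> gd; wlog st : s t / toR s <= toR t.
  move=> hw; have [|/ltW ts] := leP (toR s) (toR t); first exact: hw.
  have [z zts gz] := hw _ _ ts; exists z; first by rewrite betweenC.
  by rewrite -opprB gz -mulrN opprB.
have gc : continuous g by move=> x; apply: differentiable_at_continuous.
have := toR_itv t; have := toR_itv s => /andP[s0 _] /andP[_ t1].
have [x xst | |r] := @MVT_segment _ (g \o @to_X R) (fun r => D g (to_X r)) _ _ st.
- move: xst; rewrite in_itv /= => /andP[sx xt].
  by apply: is_derive_to_X; [lra|exact: gd].
- by apply: continuous_subspaceT; apply: continuous_comp_to_X.
rewrite in_itv /= !toRK => /andP[sr rt] E.
by exists (to_X r) => //; apply: between_le; rewrite to_XK//; lra.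
Qed.

End calculus.

Section expansion.
Variables (R : realType) (f : X R -> X R).
Hypothesis fC1 : class_C 1 setT (toR \o f).
Implicit Types x y s t z : X R.
Local Notation Df := (D (toR \o f)).

Lemma C1_differentiable x : differentiable_at (toR \o f) x.
Proof. by have [/(_ 0%N x) h _] := fC1; apply: h. Qed.

Lemma C1_D_continuous : continuous Df.
Proof. by move=> x; have [_ h] := fC1; apply: h. Qed.

Lemma C1_continuous : continuous f.
Proof.
move=> x A /nbhs_toRP[e e0 xA].
have /cvgrPdist_lt/(_ _ e0)/nbhs_toRP[d d0 hd] :=
  differentiable_at_continuous (@C1_differentiable x).
by apply/nbhs_toRP; exists d => // y /hd; exact: xA.
Qed.

Lemma slope s t : exists2 z, between s t z &
  `|toR (f s) - toR (f t)| = `|Df z| * `|toR s - toR t|.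
Proof.
have [z stz E] := X_MVT s t (@C1_differentiable); exists z => //.
by rewrite distrC (distrC (toR s)) -normrM -E.
Qed.

Lemma C1_lipschitz : exists2 L : R, 1 <= L & (forall x, `|Df x| <= L) /\
  forall n x y, `|toR (iter n f x) - toR (iter n f y)| <= L ^+ n * `|toR x - toR y|.
Proof.
have [B B0 fB] := X_bounded C1_D_continuous.
exists (B + 1); first by rewrite lerDr ltW.
have fL x : `|Df x| <= B + 1 by rewrite (le_trans (fB x))// lerDl.
split=> // n x y; elim: n => [|n IHn]; first by rewrite expr0 mul1r.
have [z _ E] := slope (iter n f x) (iter n f y).
rewrite !iterS E exprS -mulrA ler_pM//.
Qed.

(** A continuous majorant of log |Df|, as the flat critical point makes
    log |Df| itself unbounded below. *)
Definition log_deriv (K : R) x : R := ln (Num.max `|Df x| (expR (- K))).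

Lemma max_expR_gt0 (K : R) x : 0 < Num.max `|Df x| (expR (- K)).
Proof. by rewrite lt_max expR_gt0 orbT. Qed.

Lemma log_deriv_continuous K : continuous (log_deriv K).
Proof.
move=> x; apply: (@continuous_comp _ _ _ (fun x => Num.max `|Df x| (expR (- K))) (@ln R)).
  apply: (@continuous_max _ _ (fun x => `|Df x|) (fun=> expR (- K))).
    exact: (cvg_norm (@C1_D_continuous x)).
  exact: cst_continuous.
exact/continuous_ln/max_expR_gt0.
Qed.

Lemma log_deriv_ge K x : `|Df x| <= expR (log_deriv K x).
Proof. by rewrite lnK ?posrE ?max_expR_gt0// le_max lexx. Qed.

Lemma log_deriv_eq K x : expR (- K) <= `|Df x| -> log_deriv K x = ln `|Df x|.
Proof. by move=> h; rewrite /log_deriv max_l. Qed.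

Lemma log_deriv_le (L K : R) x : `|Df x| <= L -> 1 <= L -> 0 <= K -> log_deriv K x <= ln L.
Proof.
move=> DL L1 K0; rewrite ler_ln ?posrE ?max_expR_gt0//; last by rewrite (lt_le_trans ltr01).
by rewrite ge_max DL (le_trans _ L1)// -expR0 ler_expR oppr_le0.
Qed.

(** On e-small images the mean value theorem evaluates Df at points close to the
    orbit of [x], where psi differs by at most [d] from its value on the orbit. *)
Lemma bowen_stretch (psi : X R -> R) (d : R) : continuous psi -> 0 < d ->
  (forall x, `|Df x| <= expR (psi x)) ->
  exists2 e : R, 0 < e & forall n x s t,
    (forall z, between s t z -> forall i, (i < n)%N ->
      `|toR (iter i f x) - toR (iter i f z)| <= e) ->
    `|toR (iter n f s) - toR (iter n f t)| <=
      expR (\sum_(i < n) (psi (iter i f x) + d)) * `|toR s - toR t|.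
Proof.
move=> psic d0 fpsi; have [e e0 psie] := X_unif_continuous psic d0.
exists e => // n x s t; elim: n => [|n IHn] h.
  by rewrite big_ord0 expR0 mul1r.
have {}IHn := IHn (fun z sz i ni => h z sz i (leqW ni)).
have [z sz E] := slope (iter n f s) (iter n f t).
rewrite !iterS E big_ord_recr /= addrC expRD -mulrA ler_pM//.
rewrite (le_trans (fpsi z))// ler_expR.
have [w stw wz] := X_map_IVT (@continuous_iter _ f n C1_continuous) sz.
have := psie _ _ (h w stw n (ltnSn n)); rewrite wz distrC ler_norml; lra.
Qed.

(** The Bowen interval contains two points that f^(n + N) sends to 0 and 1. Their
    n-th images are therefore at distance at least L^(- N), and [bowen_stretch]
    bounds the original interval from below. Its length [e] is at most 1/2 so
    that there is room for it on one side of [x]. *)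
Lemma bowen_volume (psi : X R -> R) (d : R) : continuous psi -> 0 < d ->
  topologically_exact f -> (forall x, `|Df x| <= expR (psi x)) ->
  forall e0 : R, 0 < e0 -> exists2 tau : R, 0 < tau & forall n x,
  exists y, (forall s, between x y s -> forall i, (i < n)%N ->
      `|toR (iter i f x) - toR (iter i f s)| <= e0) /\
    tau * expR (- \sum_(i < n) (psi (iter i f x) + d)) <= `|toR x - toR y|.
Proof.
move=> psic d0 fex fpsi e1 e10.
have [e2 e20 He] := bowen_stretch psic d0 fpsi.
pose e := Num.min (Num.min e1 e2) (1 / 2).
have e0 : 0 < e by rewrite !lt_min e10 e20/=; lra.
have [N HN] := exact_spread C1_continuous fex e0.
have [L L1 [_ HL]] := C1_lipschitz.
have L0 : 0 < L by rewrite (lt_le_trans ltr01).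
exists (L ^+ N)^-1 => [|n x]; first by rewrite invr_gt0 exprn_gt0.
have [z xz] : exists z, e <= `|toR x - toR z|.
  have /andP[x0 x1] := toR_itv x.
  have e12 : e <= 1 / 2 by rewrite /e ge_min lexx orbT.
  have [x2|x2] := leP (toR x) (1 / 2).
    by exists (to_X 1); rewrite to_XK ?ler01 ?lexx// ler0_norm; lra.
  by exists (to_X 0); rewrite to_XK ?ler01 ?lexx// ger0_norm; lra.
have [y [_ ys [i ni yi]]] := bowen_interval C1_continuous n (ltW e0) xz.
exists y; split=> [s xys j nj|].
  by apply: le_trans (ys s xys j (ltnW nj)) _; rewrite /e !ge_min lexx.
have inN : (i + N <= n + N)%N by rewrite leq_add2r.
have [s0 ys0 Es0] := HN i x y (eq_ind_r (fun u => e <= u) (lexx _) yi) _ inN (to_X 0).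
have [s1 ys1 Es1] := HN i x y (eq_ind_r (fun u => e <= u) (lexx _) yi) _ inN (to_X 1).
have : 1 <= L ^+ N * `|toR (iter n f s0) - toR (iter n f s1)|.
  apply: le_trans (HL N _ _); rewrite -!iterD addnC Es0 Es1 !to_XK ?ler01 ?lexx//.
  by rewrite sub0r normrN1.
have := He n x s0 s1 (fun w sw j nj => le_trans (ys w (between_sub ys0 ys1 sw) j (ltnW nj)) _).
set S := \sum_(i < n) _ => /(_ _)/wrap[|hS h1].
  by move=> *; rewrite /e !ge_min lexx ?orbT.
rewrite expRN -invfM -div1r ler_pdivrMr ?mulr_gt0 ?exprn_gt0 ?expR_gt0//.
rewrite mulrC -mulrA; apply: le_trans h1 _; rewrite ler_wpM2l// ?exprn_ge0 ?(ltW L0)//.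
by apply: le_trans hS _; rewrite ler_wpM2l ?expR_ge0// (between_dist ys0 ys1).
Qed.

End expansion.

(** * Integration of bounded functions against a probability *)

Section measurability.
Variable R : realType.

Lemma X_measurable_open (U : set (X R)) : open U -> measurable U.
Proof. by move=> oU; apply: sub_sigma_algebra. Qed.

Lemma continuous_measurable (g : X R -> R) : continuous g -> measurable_fun setT g.
Proof.
move=> /continuousP gc; apply: (measurability _ (RGenOpens.measurableE R)).
move=> _ [_ [a [b ->] <-]]; rewrite setTI; apply: X_measurable_open.
by apply: gc; exact: interval_open.
Qed.

Lemma continuous_measurable_map (f : X R -> X R) : continuous f ->
  measurable_fun setT f.
Proof.
move=> /continuousP fc; apply: (@measurability _ _ _ _ _ _ (@open (X R)) erefl).
by move=> _ [U oU <-]; rewrite setTI; apply: X_measurable_open; exact: fc.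
Qed.

End measurability.

Section bounded_integrals.
Context d (T : measurableType d) (R : realType) (P : probability T R).
Implicit Types g h : T -> R.
Local Notation E := (fun g : T -> R => \int[P]_x g x).

(** All real integrands below are of this kind, which settles their
    integrability once and for all. *)
Definition bmeas g :=
  measurable_fun setT g /\ exists B, forall x, `|g x| <= B.

Lemma bmeas_cst r : bmeas (fun=> r).
Proof. by split; [exact: measurable_cst|exists `|r|]. Qed.

Lemma bmeasD g h : bmeas g -> bmeas h -> bmeas (fun x => g x + h x).
Proof.
move=> [mg [B gB]] [mh [C hC]]; split; first exact: measurable_funD.
by exists (B + C) => x; rewrite (le_trans (ler_normD _ _))// lerD.
Qed.

Lemma bmeasM g h : bmeas g -> bmeas h -> bmeas (fun x => g x * h x).
Proof.
move=> [mg [B gB]] [mh [C hC]]; split; first exact: measurable_funM.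
by exists (B * C) => x; rewrite normrM ler_pM.
Qed.

Lemma bmeasN g : bmeas g -> bmeas (fun x => - g x).
Proof.
move=> [mg [B gB]]; split; first exact: measurable_funN.
by exists B => x; rewrite normrN.
Qed.

Lemma bmeasB g h : bmeas g -> bmeas h -> bmeas (fun x => g x - h x).
Proof. by move=> mg mh; apply: bmeasD => //; exact: bmeasN. Qed.

Lemma bmeas_norm g : bmeas g -> bmeas (fun x => `|g x|).
Proof.
move=> [mg [B gB]]; split; last by exists B => x; rewrite normr_id.
exact: measurableT_comp.
Qed.

Lemma bmeas_sum (I : Type) (s : seq I) (Q : pred I) (g : I -> T -> R) :
  (forall i, bmeas (g i)) -> bmeas (fun x => \sum_(i <- s | Q i) g i x).
Proof.
move=> mg; elim: s => [|i s IHs].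
  by under eq_fun do rewrite big_nil; exact: bmeas_cst.
under eq_fun do rewrite big_cons; case: (Q i) => //.
exact: bmeasD.
Qed.

Lemma bmeas_indic (A : set T) : measurable A -> bmeas (fun x => \1_A x).
Proof.
move=> mA; split; first exact: measurable_indic.
by exists 1 => x; rewrite indicE; case: (_ \in _); rewrite ?normr1 ?normr0 ?ler01.
Qed.

Lemma bmeas_comp g (f : T -> T) : measurable_fun setT f -> bmeas g ->
  bmeas (fun x => g (f x)).
Proof.
move=> mf [mg [B gB]]; split; last by exists B => x.
exact: measurableT_comp.
Qed.

Lemma bmeas_integrable g : bmeas g -> P.-integrable setT (EFin \o g).
Proof.
move=> [mg [B gB]]; apply: measurable_bounded_integrable => //.
  by rewrite -ge0_fin_numE ?fin_num_measure.
exists B; split; first exact: num_real.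
by move=> C BC x _ /=; rewrite (le_trans (gB x))// ltW.
Qed.

Lemma prob_int_cst r : \int[P]_x r = r.
Proof. by rewrite Rintegral_cst// [X in fine X]probability_setT mulr1. Qed.

Lemma prob_intD g h : bmeas g -> bmeas h -> \int[P]_x (g x + h x) = E g + E h.
Proof. by move=> mg mh; rewrite RintegralD//; exact: bmeas_integrable. Qed.

Lemma prob_intB g h : bmeas g -> bmeas h -> \int[P]_x (g x - h x) = E g - E h.
Proof. by move=> mg mh; rewrite RintegralB//; exact: bmeas_integrable. Qed.

Lemma prob_intZ r g : bmeas g -> \int[P]_x (r * g x) = r * E g.
Proof. by move=> mg; rewrite RintegralZl//; exact: bmeas_integrable. Qed.

Lemma prob_int_sum (I : Type) (s : seq I) (Q : pred I) (g : I -> T -> R) :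
  (forall i, bmeas (g i)) ->
  \int[P]_x (\sum_(i <- s | Q i) g i x) = \sum_(i <- s | Q i) E (g i).
Proof.
move=> mg; elim: s => [|i s IHs].
  by under eq_Rintegral do rewrite big_nil; rewrite big_nil prob_int_cst.
under eq_Rintegral do rewrite big_cons; rewrite big_cons.
by case: (Q i) => //; rewrite prob_intD ?IHs//; exact: bmeas_sum.
Qed.

Lemma prob_int_le g h : bmeas g -> bmeas h -> (forall x, g x <= h x) -> E g <= E h.
Proof. by move=> mg mh gh; apply: le_Rintegral => //; exact: bmeas_integrable. Qed.

Lemma prob_int_indic (A : set T) : measurable A -> \int[P]_x \1_A x = fine (P A).
Proof. by move=> mA; rewrite /Rintegral integral_indic// setIT. Qed.

(** Dominated convergence, for sequences that are eventually 0 at each point. *)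
Lemma prob_int_eventually0 (h : nat -> T -> R) : (forall n, measurable_fun setT (h n)) ->
  (forall n x, 0 <= h n x <= 1) ->
  (forall x, exists N, forall n, (N <= n)%N -> h n x = 0) ->
  forall e : R, 0 < e -> exists n, \int[P]_x h n x <= e.
Proof.
move=> mh h01 h0 e e0.
have := @dominated_cvg _ _ _ P setT measurableT (fun n x => (h n x)%:E) (fun=> 0%E)
  (fun=> 1%E).
have [] : (forall n, measurable_fun setT (fun x => (h n x)%:E)) /\
  P.-integrable setT (fun=> 1%E : \bar R).
  split=> [n|]; first exact/measurable_EFinP.
  exact: (bmeas_integrable (bmeas_cst 1)).
move=> m1 m2 /(_ m1 _ _ m2)/wrap[].
- move=> x _; have [N hN] := h0 x.
  apply: cvg_near_cst; exists N => // n /= Nn.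
  by rewrite hN.
- by [].
- move=> H; have {}H := H _.
  have : (\int[P]_x (h n x)%:E)%E @[n --> \oo] --> 0%E.
    have := H; rewrite integral0; apply.
    by move=> n x _; rewrite lee_fin; have /andP[h1 h2] := h01 n x; rewrite ger0_norm.
  move=> /fine_cvgP[_] /cvgrPdist_le/(_ _ e0)[N _ HN].
  exists N; have /= := HN N (leqnn N); rewrite sub0r normrN.
  by apply: le_trans; exact: ler_norm.
Qed.

End bounded_integrals.

Section invariance.
Variables (R : realType) (f : X R -> X R) (nu : M R).
Hypotheses (fm : measurable_fun setT f) (nuinv : invariant_measure f nu).
Local Notation P := (nu : probability (X R) R).

Lemma measurable_iter n : measurable_fun setT (iter n f).
Proof.
elim: n => [|n IHn]; first exact: measurable_id.
by apply: (@measurableT_comp _ _ _ _ _ _ f).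
Qed.

Lemma prob_int_invariant (g : X R -> R) : bmeas g -> \int[P]_x g (f x) = \int[P]_x g x.
Proof.
move=> mg; have mgf := bmeas_comp fm mg.
rewrite /Rintegral; congr fine.
have mge : measurable_fun setT (EFin \o g) by apply/measurable_EFinP; exact: mg.1.
have := integral_pushforward fm mge _ measurableT (mu := P).
move=> /(_ (bmeas_integrable P mgf)) <-.
apply: eq_measure_integral => A mA _.
exact: (nuinv mA).
Qed.

Lemma prob_int_invariant_iter (g : X R -> R) n : bmeas g ->
  \int[P]_x g (iter n f x) = \int[P]_x g x.
Proof.
move=> mg; elim: n => [//|n IHn]; rewrite -IHn.
under eq_Rintegral do rewrite iterSr.
apply: (@prob_int_invariant (fun x => g (iter n f x))).
exact: (bmeas_comp (@measurable_iter n) mg).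
Qed.

End invariance.

(** * Approximation of Borel partitions by continuous functions *)

Section approximation.
Variables (R : realType) (P : probability (X R) R).
Implicit Types (A B U : set (X R)) (g : X R -> R).

Lemma continuous_bmeas g : continuous g -> bmeas g.
Proof.
move=> gc; split; first exact: continuous_measurable.
by have [B _ gB] := X_bounded gc; exists B.
Qed.

(** The sets whose indicators are limits in L^1 of continuous functions with
    values in [0, 1]; they form a sigma-algebra containing the open sets. *)
Definition approximable A := measurable A /\
  forall e : R, 0 < e -> exists g : X R -> R, [/\ continuous g, forall x, 0 <= g x <= 1 &
    \int[P]_x `|g x - \1_A x| <= e].

Lemma dist_bool (u : R) (b : bool) : 0 <= u <= 1 ->
  `|u - b%:R| = if b then 1 - u else u.
Proof.
move=> /andP[u0 u1]; case: b; last by rewrite subr0 ger0_norm.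
by rewrite ler0_norm ?subr_le0// opprB.
Qed.

Lemma bmeas_dist g A : continuous g -> measurable A ->
  bmeas (fun x => `|g x - \1_A x|).
Proof.
move=> gc mA; apply: bmeas_norm; apply: bmeasB; last exact: bmeas_indic.
exact: continuous_bmeas.
Qed.

Lemma approximableC A : approximable A -> approximable (~` A).
Proof.
move=> [mA hA]; split=> [|e e0]; first exact: measurableC.
have [g [gc g01 ge]] := hA e e0.
exists (fun x => 1 - g x); split=> [x|x|].
- exact: (cvgB (cvg_cst _) (gc x)).
- by have := g01 x; lra.
- rewrite (@eq_Rintegral _ _ _ _ _ (fun x => `|g x - \1_A x|))// => x _.
  rewrite !indicE in_setC !dist_bool//; last by have := g01 x; lra.
  by case: (x \in A) => /=; lra.
Qed.

Lemma approximableU A B : approximable A -> approximable B -> approximable (A `|` B).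
Proof.
move=> [mA hA] [mB hB]; split=> [|e e0]; first exact: measurableU.
have e20 : 0 < e / 2 by lra.
have [g [gc g01 ge]] := hA _ e20; have [h [hc h01 he]] := hB _ e20.
exists (fun x => Num.max (g x) (h x)); split=> [x|x|].
- exact: (@continuous_max _ _ g h x (gc x) (hc x)).
- by have := g01 x; have := h01 x; case: (leP (g x) (h x)) => _; lra.
- have mg := bmeas_dist gc mA; have mh := bmeas_dist hc mB.
  apply: (@le_trans _ _ (\int[P]_x (`|g x - \1_A x| + `|h x - \1_B x|))).
    apply: prob_int_le; [|exact: bmeasD|].
      apply: bmeas_dist; last exact: measurableU.
      by move=> x; exact: (@continuous_max _ _ g h x (gc x) (hc x)).
    move=> x; rewrite !indicE in_setU !dist_bool//; last first.
      by have := g01 x; have := h01 x; case: (leP (g x) (h x)) => _; lra.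
    have := g01 x; have := h01 x.
    by case: (x \in A); case: (x \in B) => /=; case: (leP (g x) (h x)) => ? ? ?; lra.
  by rewrite prob_intD//; lra.
Qed.

Lemma approximable_bigcup (A : (set (X R))^nat) :
  (forall n, approximable (A n)) -> approximable (\bigcup_n A n).
Proof.
move=> hA; pose B n := \big[setU/set0]_(i < n.+1) A i.
have mA i : measurable (A i) by have [] := hA i.
have mU : measurable (\bigcup_n A n) by apply: bigcupT_measurable.
have hB n : approximable (B n).
  rewrite /B; elim: n => [|n IHn]; first by rewrite big_ord_recr big_ord0 /= set0U.
  by rewrite big_ord_recr /=; apply: approximableU.
split=> // e e0; have e20 : 0 < e / 2 by lra.
have BA n : B n `<=` \bigcup_n A n.
  by rewrite /B -bigcup_mkord => x [i _ ?]; exists i.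
have [n hn] : exists n, \int[P]_x (\1_(\bigcup_n A n) x - \1_(B n) x) <= e / 2.
  apply: prob_int_eventually0 e20 => [n|n x|x].
  - by apply: measurable_funB; apply: measurable_indic => //; have [] := hB n.
  - rewrite !indicE; have [xB|xB] := boolP (x \in B n).
      by rewrite (_ : x \in _) ?subrr ?lexx ?ler01//; rewrite inE; apply: (BA n); rewrite inE in xB.
    by case: (_ \in _); rewrite subr0 ?lexx ?ler01.
  - have [[i _ xAi]|xA] := pselect ((\bigcup_n A n) x).
      exists i => n ni; rewrite !indicE mem_set; last by exists i.
      rewrite mem_set ?subrr//; rewrite /B -bigcup_mkord; exists i => //=.
    exists 0%N => n _; rewrite !indicE !memNset ?subrr//.
    by move=> /BA.
have [g [gc g01 ge]] := (hB n).2 _ e20; have mBn := (hB n).1.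
exists g; split=> //; have mg := bmeas_dist gc mBn.
have mi : bmeas (fun x => \1_(\bigcup_n A n) x - \1_(B n) x : R).
  by apply: bmeasB; apply: bmeas_indic.
apply: (@le_trans _ _ (\int[P]_x (`|g x - \1_(B n) x| + (\1_(\bigcup_n A n) x - \1_(B n) x)))).
  apply: prob_int_le; [exact: bmeas_dist|exact: bmeasD|] => x.
  rewrite !indicE !dist_bool//; have [xB|xB] := boolP (x \in B n).
    by rewrite (_ : x \in _); [lra|rewrite inE; apply: (BA n); rewrite inE in xB].
  by have := g01 x; case: (_ \in _) => /=; lra.
by rewrite prob_intD//; lra.
Qed.

(** The Urysohn functions separating the complement of [U] from the points at
    depth at least 1/(n + 1) in [U] are eventually equal to the indicator of [U]
    at each point. *)
Lemma approximable_open U : open U -> approximable U.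
Proof.
move=> oU; have mU := X_measurable_open oU; split=> // e e0.
pose F n := [set x : X R | forall y, `|toR x - toR y| < n.+1%:R^-1 -> U y].
pose g n : X R -> R := Urysohn (~` U) (F n).
have sep n : uniform_separator (~` U) (F n).
  apply: uniform_separatorW; exists [set xy : X R * X R | ball xy.1 n.+1%:R^-1 xy.2].
    by rewrite -entourage_ballE; exists n.+1%:R^-1; rewrite /= ?invr_gt0.
  apply/seteqP; split=> // -[x y] /= [[nUx Fy] xy]; apply: nUx.
  by apply: Fy; rewrite distrC; exact: xy.
have gc n : continuous (g n) by exact: Urysohn_continuous.
have g01 n x : 0 <= g n x <= 1.
  by have : (range (g n)) (g n x) by []; move=> /Urysohn_range; rewrite /= in_itv.
have [n hn] : exists n, \int[P]_x `|g n x - \1_U x| <= e.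
  apply: prob_int_eventually0 e0 => [n|n x|x].
  - exact: (bmeas_dist (gc n) mU).1.
  - by rewrite indicE dist_bool//; have := g01 n x; case: (_ \in _); lra.
  - have [Ux|nUx] := pselect (U x); last first.
      exists 0%N => n _; rewrite indicE memNset// subr0.
      have -> : g n x = 0 by apply: (Urysohn_sub0 (sep n)); exists x.
      by rewrite normr0.
    have [d d0 xd] : exists2 d : R, 0 < d & forall y, `|toR x - toR y| < d -> U y.
      by apply/nbhs_toRP; apply: open_nbhs_nbhs.
    exists (Num.truncn d^-1) => n nd; rewrite indicE mem_set//.
    have -> : g n x = 1; last by rewrite subrr normr0.
    apply: (Urysohn_sub1 (sep n)); exists x => // y xy; apply: xd.
    apply: lt_le_trans xy _; rewrite -[leRHS]invrK lef_pV2 ?posrE ?invr_gt0//.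
    by apply: ltW; apply: lt_le_trans (truncnS_gt _) _; rewrite ler_nat ltnS.
by exists (g n).
Qed.

Lemma measurable_approximable A : measurable A -> approximable A.
Proof.
move: A; apply: smallest_sub; last exact: approximable_open.
split=> [|A hA|A hA].
- exact/approximable_open/open0.
- by rewrite setTD; exact: approximableC.
- exact: approximable_bigcup.
Qed.

End approximation.

Lemma continuous_sum (R : realType) (I : Type) (s : seq I) (g : I -> X R -> R) :
  (forall i, continuous (g i)) -> continuous (fun x => \sum_(i <- s) g i x).
Proof.
move=> gc; elim: s => [|i s IHs].
  rewrite (_ : (fun x => _) = cst 0); first exact: cst_continuous.
  by apply/funext => x; rewrite big_nil.
rewrite (_ : (fun x => _) = (fun x => g i x + \sum_(i <- s) g i x)).
  by move=> x; exact: (cvgD (gc i x) (IHs x)).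
by apply/funext => x; rewrite big_cons.
Qed.

(** The function [a i] is the predicted probability of the label [i]. The
    indicators of the atoms are approximated in L^1 by continuous g_i, and
    a_i is the normalization of g_i + kap. The floor kap keeps logarithms
    bounded: - ln a_i <= (sum_j g_j - 1) + k kap + (1 - g_i) / kap, whose integral
    is small once the approximation error is small with respect to kap. *)
Lemma partition_of_unity (R : realType) (P : probability (X R) R) k
    (xi : X R -> 'I_k) : (forall i, measurable (xi @^-1` [set i])) ->
  forall e : R, 0 < e -> exists a : 'I_k -> X R -> R,
  [/\ forall i, continuous (a i), forall i x, 0 < a i x,
      forall x, \sum_i a i x = 1 &
      exists cost : X R -> R, [/\ bmeas cost, forall x, - ln (a (xi x) x) <= cost x &
        \int[P]_x cost x <= e]].
Proof.
move=> mxi e e0.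
have k0 : (0 < k)%N by case: k xi mxi => // xi _; case: (xi point).
pose K : R := k%:R; have K0 : 0 < K by rewrite ltr0n.
pose kap := e / (2 * K); have kap0 : 0 < kap by rewrite divr_gt0// mulr_gt0.
pose th := e / (2 * K * (1 + kap^-1)).
have th0 : 0 < th by rewrite divr_gt0// !mulr_gt0// addr_gt0// invr_gt0.
have /choice[g gP] : forall i, exists g : X R -> R, [/\ continuous g, forall x, 0 <= g x <= 1 &
    \int[P]_x `|g x - \1_(xi @^-1` [set i]) x| <= th].
  by move=> i; apply: (measurable_approximable P (mxi i)).2.
have gc i : continuous (g i) by have [] := gP i.
have g01 i x : 0 <= g i x <= 1 by have [_ h _] := gP i.
pose S x := \sum_i (g i x + kap).
have gk i x : 0 < g i x + kap by have /andP[? _] := g01 i x; rewrite ltr_wpDl.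
have S0 x : 0 < S x.
  have i0 : 'I_k by exists 0%N.
  rewrite /S (bigD1 i0)//= ltr_pwDl//; apply: sumr_ge0 => i _; exact: ltW.
have Sc : continuous S.
  by apply: continuous_sum => i x; exact: (cvgD (gc i x) (cvg_cst _)).
pose dst i x : R := `|g i x - \1_(xi @^-1` [set i]) x|.
have mdst i : bmeas (dst i) by apply: bmeas_dist.
exists (fun i x => (g i x + kap) / S x); split=> [i x|i x|x|].
- apply: (cvgM (cvgD (gc i x) (cvg_cst _)) (cvgV _ (Sc x))).
  by rewrite gt_eqF.
- exact: divr_gt0.
- by rewrite -mulr_suml divff//; apply: lt0r_neq0; exact: S0.
exists (fun x => K * kap + (1 + kap^-1) * \sum_i dst i x); split=> [|x|].
- apply: bmeasD; first exact: bmeas_cst.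
  apply: bmeasM; first exact: bmeas_cst.
  exact: bmeas_sum.
- rewrite ln_div ?posrE// opprB.
  have lnS : ln (S x) <= \sum_i dst i x + K * kap.
    apply: (@le_trans _ _ (S x - 1)).
      have := @le_ln1Dx R (S x - 1); rewrite addrCA subrr addr0; apply.
      by have := S0 x; lra.
    have -> : S x = \sum_i g i x + K * kap.
      by rewrite /S big_split /= sumr_const card_ord mulr_natl.
    have one : 1 = \sum_i \1_(xi @^-1` [set i]) x :> R.
      rewrite (bigD1 (xi x))//= indicE mem_set// big1 ?addr0// => i ix.
      by rewrite indicE memNset//= => xix; rewrite xix eqxx in ix.
    have : \sum_i g i x - \sum_i \1_(xi @^-1` [set i]) x <= \sum_i dst i x.
      by rewrite -sumrB; apply: ler_sum => i _; exact: ler_norm.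
    by rewrite -one; lra.
  have lng : - ln (g (xi x) x + kap) <= kap^-1 * \sum_i dst i x.
    apply: (@le_trans _ _ (kap^-1 * dst (xi x) x)); last first.
      rewrite ler_pM2l ?invr_gt0// (bigD1 (xi x))//= lerDl.
      by apply: sumr_ge0 => i _; rewrite normr_ge0.
    rewrite -lnV ?posrE//.
    have -> : dst (xi x) x = 1 - g (xi x) x.
      by rewrite /dst indicE mem_set// dist_bool.
    have gx := gk (xi x) x; have /andP[g0 g1] := g01 (xi x) x.
    apply: (@le_trans _ _ ((g (xi x) x + kap)^-1 - 1)).
      have := @le_ln1Dx R ((g (xi x) x + kap)^-1 - 1).
      by rewrite addrCA subrr addr0; apply; rewrite ltrBDl subrr invr_gt0.
    have -> : (g (xi x) x + kap)^-1 - 1 = (1 - g (xi x) x - kap) / (g (xi x) x + kap).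
      by field; rewrite gt_eqF.
    rewrite ler_pdivrMr// mulrAC -mulrA ler_pdivlMl//.
    have [|] := leP 0 (1 - g (xi x) x - kap); nra.
  by rewrite mulrDl mul1r; lra.
have mS : bmeas (fun x => \sum_i dst i x) by exact: bmeas_sum.
rewrite (prob_intD P (bmeas_cst _ _) (bmeasM (bmeas_cst _ (1 + kap^-1)) mS)).
rewrite prob_int_cst (prob_intZ P _ mS) prob_int_sum//.
have : \sum_i \int[P]_x dst i x <= K * th.
  rewrite /K mulr_natl -[X in th *+ X]card_ord -sumr_const; apply: ler_sum => i _.
  by have [] := gP i.
have c0 : 0 < 1 + kap^-1 by rewrite addr_gt0// invr_gt0.
move=> /(ler_wpM2l (ltW c0)).
have -> : (1 + kap^-1) * (K * th) = e / 2.
  by rewrite /th; field; rewrite !gt_eqF//=; lra.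
have -> : K * kap = e / 2 by rewrite /kap; field; rewrite gt_eqF.
lra.
Qed.

(** * Entropy of a partition against the length of Bowen intervals *)

(** Termwise p ln (q / p) <= q - p. *)
Lemma gibbs_inequality (R : realType) (W : finType) (p q : W -> R) :
  (forall w, 0 <= p w) -> (forall w, 0 < q w) -> \sum_w q w <= \sum_w p w ->
  - \sum_w p w * ln (p w) <= \sum_w p w * - ln (q w).
Proof.
move=> p0 q0 qp; rewrite -subr_ge0 opprK -big_split /=.
apply: (@le_trans _ _ (\sum_w (p w - q w))).
  by rewrite sumrB subr_ge0.
apply: ler_sum => w _; rewrite -mulrDr.
have := p0 w; rewrite le_eqVlt => /predU1P[<-|pw].
  by rewrite mul0r sub0r oppr_le0 ltW.
rewrite [- ln _ + _]addrC -ln_div ?posrE//.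
have := @le_ln1Dx R (q w / p w - 1).
rewrite addrCA subrr addr0 ltrBDl subrr divr_gt0// => /(_ isT).
rewrite -[ln (p w / q w)]opprK -lnV ?posrE ?divr_gt0// invf_div => h.
have : p w * ln (q w / p w) <= p w * (q w / p w - 1) by rewrite ler_pM2l.
rewrite mulrBr mulr1 mulrCA divff ?gt_eqF// mulr1; lra.
Qed.

(** An interval contains at least M |x - y| - 1 points of the grid k/M. Averages
    over a fine grid play the role of Lebesgue measure, which keeps the weights
    of words finite sums. *)
Lemma grid_sum (R : realType) (x y : X R) (M : nat) (h : nat -> R) (v : R) :
  (0 < M)%N -> 0 <= v -> (forall k, 0 <= h k) ->
  (forall k, between x y (to_X (k%:R / M%:R)) -> v <= h k) ->
  v * (M%:R * `|toR x - toR y| - 1) <= \sum_(k < M) h k.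
Proof.
move=> M0 v0 h0; wlog xy : x y / toR x <= toR y.
  move=> hw; have [|/ltW yx] := leP (toR x) (toR y); first exact: hw.
  rewrite distrC => H; apply: hw => // k; rewrite betweenC; exact: H.
rewrite distrC ger0_norm ?subr_ge0// => hv.
have MR : 0 < M%:R :> R by rewrite ltr0n.
have /andP[x0 x1] := toR_itv x; have /andP[y0 y1] := toR_itv y.
pose i0 := (Num.truncn (M%:R * toR x)).+1.
pose j0 := minn M (Num.truncn (M%:R * toR y)).+1.
have xi0 : M%:R * toR x < i0%:R by rewrite truncnS_gt.
have i0x : i0%:R <= M%:R * toR x + 1.
  by rewrite -natr1 lerD2r truncn_le mulr_ge0// ltW.
have yj0 : M%:R * toR y <= j0%:R.
  rewrite /j0 /minn; case: ifP => _; last by rewrite ltW// truncnS_gt.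
  by rewrite ler_piMr// ltW.
have [ij|ji] := leqP i0 j0; last first.
  apply: (@le_trans _ _ 0); last by apply: sumr_ge0.
  rewrite mulr_ge0_le0//; have : j0%:R < i0%:R :> R by rewrite ltr_nat.
  by rewrite mulrBr; lra.
have jM : (j0 <= M)%N by rewrite geq_minl.
rewrite -(big_mkord xpredT h) (@big_cat_nat _ _ _ i0)//=; last exact: leq_trans jM.
rewrite (@big_cat_nat _ _ _ j0 i0)//=.
have s1 : 0 <= \sum_(0 <= i < i0) h i by apply: sumr_ge0.
have s3 : 0 <= \sum_(j0 <= i < M) h i by apply: sumr_ge0.
suff : v * (M%:R * (toR y - toR x) - 1) <= \sum_(i0 <= i < j0) h i by lra.
apply: (@le_trans _ _ (\sum_(i0 <= i < j0) v)).
  rewrite sumr_const_nat -[v *+ _]mulr_natr ler_wpM2l// natrB//.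
  by rewrite mulrBr; lra.
rewrite !big_nat; apply: ler_sum => i /andP[i0i ij0]; apply: hv.
have i0R : i0%:R <= i%:R :> R by rewrite ler_nat.
have iy : i%:R <= M%:R * toR y.
  have My0 : 0 <= M%:R * toR y by rewrite mulr_ge0// ltW.
  by move: (ij0); rewrite /j0 leq_min ltnS -truncn_ge_nat// => /andP[].
have iK : toR (to_X (i%:R / M%:R) : X R) = i%:R / M%:R.
  apply: to_XK; rewrite divr_ge0//= ler_pdivrMr// mul1r ler_nat.
  by rewrite ltnW// (leq_trans ij0).
apply: between_le; rewrite iK.
  by rewrite ler_pdivlMr// mulrC; apply: le_trans (ltW xi0) i0R.
by rewrite ler_pdivrMr// mulrC.
Qed.

Section ruelle.
Variables (R : realType) (f : X R -> X R) (nu : M R).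
Hypotheses (fC1 : class_C 1 setT (toR \o f)) (fex : topologically_exact f).
Hypothesis nuinv : invariant_measure f nu.
Local Notation P := (nu : probability (X R) R).
Local Notation Df := (D (toR \o f)).

Let fc := C1_continuous fC1.
Let fm := continuous_measurable_map fc.

Section labels.
Variables (k : nat) (xi : X R -> 'I_k).
Hypothesis mxi : forall i, measurable (xi @^-1` [set i]).

Lemma measurable_atom n (w : {ffun 'I_n -> 'I_k}) : measurable (atom f xi w).
Proof.
have -> : atom f xi w = \bigcap_(i in [set: 'I_n]) (iter i f @^-1` (xi @^-1` [set w i])).
  by apply/seteqP; split => [x h i _|x h i]; [exact: h|exact: (h i I)].
apply: fin_bigcap_measurable => // i _.
by have := measurable_iter fm i; move=> /(_ measurableT _ (mxi (w i))); rewrite setTI.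
Qed.

Definition word n x : {ffun 'I_n -> 'I_k} := [ffun i : 'I_n => xi (iter i f x)].

Lemma sum_indic_atom n (c : {ffun 'I_n -> 'I_k} -> R) x :
  \sum_w \1_(atom f xi w) x * c w = c (word n x).
Proof.
rewrite (bigD1 (word n x))//= indicE mem_set ?mul1r; last by move=> i; rewrite ffunE.
rewrite big1 ?addr0// => w /eqP ww; rewrite indicE memNset ?mul0r// => xw.
by apply: ww; apply/ffunP => i; rewrite ffunE -xw.
Qed.

Lemma prob_int_word n (c : {ffun 'I_n -> 'I_k} -> R) :
  \sum_w fine (P (atom f xi w)) * c w = \int[P]_x c (word n x).
Proof.
have ma w : bmeas (fun x => \1_(@atom R f k xi n w) x * c w : R).
  by apply: bmeasM; [apply: bmeas_indic; exact: measurable_atom|exact: bmeas_cst].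
under [RHS]eq_Rintegral do rewrite -sum_indic_atom.
rewrite prob_int_sum//; apply: eq_bigr => w _.
under eq_Rintegral do rewrite mulrC.
rewrite prob_intZ; last first.
  by apply: bmeas_indic; exact: measurable_atom.
by rewrite prob_int_indic; [rewrite mulrC|exact: measurable_atom].
Qed.

(** A word [w] receives as weight the average over a fine grid of the product of
    the predicted probabilities of its letters along the orbit. On the Bowen
    interval of a point with word [w] these predictions are close to those made
    at the point itself, so the weight of [w] is at least the length of that
    interval up to the prediction cost, and the Gibbs inequality compares the
    entropy with these weights. *)
Lemma refinement_entropy_le (psi : X R -> R) (e : R) : continuous psi -> 0 < e ->
  (forall x, `|Df x| <= expR (psi x)) ->
  exists C : R, forall n, refinement_entropy f nu xi n <=
    C + n%:R * (\int[P]_x psi x + e).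
Proof.
move=> psic e0 fpsi; pose d := e / 3; have d0 : 0 < d by rewrite divr_gt0.
have [a [ac a0 a1 [cost [mcost acost Ecost]]]] := partition_of_unity P mxi d0.
have lnac i : continuous (fun x => ln (a i x)).
  move=> x; apply: (@continuous_comp _ _ _ (a i) (@ln R)); first exact: ac.
  exact: continuous_ln.
have [e1 e10 ae1] : exists2 e1 : R, 0 < e1 & forall i x y, `|toR x - toR y| <= e1 ->
    ln (a i x) - d <= ln (a i y).
  have /choice[e1 e1P] : forall i, exists e1 : R, 0 < e1 /\ forall x y,
      `|toR x - toR y| <= e1 -> `|ln (a i x) - ln (a i y)| <= d.
    by move=> i; have [e1 ? ?] := X_unif_continuous (lnac i) d0; exists e1.
  exists (\big[Num.min/1]_i e1 i).
    by apply: lt_bigmin => // i _; have [] := e1P i.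
  move=> i x y xy; have [_ /(_ x y)] := e1P i.
  have -> : `|toR x - toR y| <= e1 i by apply: le_trans xy _; exact: bigmin_le.
  by move=> /(_ isT); rewrite ler_norml; lra.
have [tau tau0 vol] := bowen_volume fC1 psic (divr_gt0 d0 (ltr0Sn R 1)) fex fpsi e10.
pose d2 := d / 2.
have [B B0 psiB] := X_bounded psic.
pose Psi x := psi x + d2 + (d + cost x).
exists (- ln (tau / 2)) => n.
pose l := tau * expR (- (n%:R * (B + d2))).
have l0 : 0 < l by rewrite mulr_gt0// expR_gt0.
(* l bounds all Bowen intervals of order n from below, so that the loss of one
   grid point costs at most half of the average *)
pose M := (Num.truncn (2 / l)).+1.
have Ml : 2 <= M%:R * l by rewrite -ler_pdivrMr// ltW// truncnS_gt.
have M0 : 0 < M%:R :> R by rewrite ltr0n.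
pose node k0 : X R := to_X (k0%:R / M%:R).
pose pred (w : {ffun 'I_n -> 'I_k}) (x : X R) : R := \prod_i a (w i) (iter i f x).
have pred0 w x : 0 < pred w x by apply: prodr_gt0 => i _.
pose q w := M%:R^-1 * \sum_(k0 < M) pred w (node k0).
have q0 w : 0 < q w.
  rewrite mulr_gt0 ?invr_gt0// (bigD1 ord0)//= ltr_pwDl//.
  by apply: sumr_ge0 => i _; exact: ltW.
have q1 : \sum_w q w = 1.
  rewrite -mulr_sumr exchange_big /=.
  under eq_bigr => k0 _.
    rewrite -(bigA_distr_bigA (fun (i : 'I_n) j => a j (iter i f (node k0)))).
    under eq_bigr do rewrite a1.
    rewrite big1//; over.
  by rewrite sumr_const card_ord mulVf// gt_eqF.
(* the weight of the word of x, bounded below by the grid points of its Bowen interval *)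
have key x : - ln (q (word n x)) <= - ln (tau / 2) + \sum_(i < n) Psi (iter i f x).
  set w := word n x.
  have [y [xys xy]] := vol n x.
  set S := \sum_(i < n) _ in xy.
  have SB : S <= n%:R * (B + d2).
    have -> : n%:R * (B + d2) = \sum_(i < n) (B + d2).
      by rewrite sumr_const card_ord mulr_natl.
    apply: ler_sum => i _.
    by rewrite lerD2r (le_trans (ler_norm _)).
  have xyl : l <= `|toR x - toR y|.
    by apply: le_trans xy; rewrite ler_pM2l// ler_expR lerN2.
  pose v := expR (\sum_(i < n) (ln (a (w i) (iter i f x)) - d)).
  have vq : v * (M%:R * `|toR x - toR y| - 1) <= \sum_(k0 < M) pred w (node k0).
    apply: (@grid_sum _ _ _ M (fun j => pred w (node j))) => [|||j xyj].
    - by [].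
    - exact: expR_ge0.
    - by move=> j; exact: ltW.
    rewrite /v expR_sum; apply: ler_prod => i _.
    rewrite expR_ge0 -[leRHS]lnK ?posrE// ler_expR; apply: ae1.
    exact: xys.
  have vtau : v * (tau / 2 * expR (- S)) <= q w.
    rewrite /q ler_pdivlMl//; apply: le_trans vq.
    rewrite mulrCA ler_pM2l ?expR_gt0//.
    have h1 : M%:R * l <= M%:R * `|toR x - toR y| by rewrite ler_pM2l.
    have h2 : M%:R * (tau * expR (- S)) <= M%:R * `|toR x - toR y| by rewrite ler_pM2l.
    have -> : M%:R * (tau / 2 * expR (- S)) = M%:R * (tau * expR (- S)) / 2 by ring.
    lra.
  have : ln (v * (tau / 2 * expR (- S))) <= ln (q w).
    by rewrite ler_ln ?posrE// !mulr_gt0 ?expR_gt0.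
  rewrite lnM ?posrE ?mulr_gt0 ?divr_gt0 ?expR_gt0//.
  rewrite [ln (_ * expR _)]lnM ?posrE ?divr_gt0 ?expR_gt0// /v !expRK => hq.
  have : - \sum_(i < n) (ln (a (w i) (iter i f x)) - d) + S <= \sum_(i < n) Psi (iter i f x).
    rewrite /S -sumrN -big_split /=; apply: ler_sum => i _.
    have := acost (iter i f x); rewrite /w ffunE /Psi /d2; lra.
  lra.
have mPsi : bmeas Psi.
  apply: bmeasD; first by apply: bmeasD; [exact: continuous_bmeas|exact: bmeas_cst].
  by apply: bmeasD => //; exact: bmeas_cst.
have mPsin : bmeas (fun x => \sum_(i < n) Psi (iter i f x)).
  by apply: bmeas_sum => i; apply: (bmeas_comp (measurable_iter fm i)).
have EPsi : \int[P]_x Psi x <= \int[P]_x psi x + e.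
  have mpsi := continuous_bmeas psic.
  rewrite /Psi (prob_intD P (bmeasD mpsi (bmeas_cst _ _)) (bmeasD (bmeas_cst _ d) mcost)).
  rewrite (prob_intD P mpsi (bmeas_cst _ _)) (prob_intD P (bmeas_cst _ d) mcost) !prob_int_cst.
  by rewrite /d2 /d in Ecost *; lra.
apply: (@le_trans _ _ (\sum_w fine (P (atom f xi w)) * - ln (q w))).
  rewrite /refinement_entropy /=; apply: gibbs_inequality => //.
    by move=> w; rewrite fine_ge0.
  rewrite q1; have := prob_int_word (n := n) (fun=> 1); rewrite prob_int_cst.
  by under eq_bigr do rewrite mulr1; move=> ->.
rewrite prob_int_word.
apply: (@le_trans _ _ (\int[P]_x (- ln (tau / 2) + \sum_(i < n) Psi (iter i f x)))).
  apply: prob_int_le => //; last by apply: bmeasD => //; exact: bmeas_cst.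
  rewrite (_ : (fun x => _) = fun x => \sum_w \1_(@atom R f k xi n w) x * - ln (q w)).
    apply: bmeas_sum => w.
    by apply: bmeasM; [apply: bmeas_indic; exact: measurable_atom|exact: bmeas_cst].
  by apply/funext => x; rewrite sum_indic_atom.
rewrite (prob_intD P (bmeas_cst _ _) mPsin) prob_int_cst lerD2l prob_int_sum; last first.
  by move=> i; apply: (bmeas_comp (measurable_iter fm i)).
have -> : n%:R * (\int[P]_x psi x + e) = \sum_(i < n) (\int[P]_x psi x + e).
  by rewrite sumr_const card_ord mulr_natl.
apply: ler_sum => i _.
by rewrite (prob_int_invariant_iter fm nuinv).
Qed.

End labels.
End ruelle.

(** * Ruelle's inequality *)

Section ruelle_inequality.
Variables (R : realType) (f : X R -> X R).
Hypotheses (fC1 : class_C 1 setT (toR \o f)) (fex : topologically_exact f).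
Local Notation Df := (D (toR \o f)).

Let fc := C1_continuous fC1.
Let fm := continuous_measurable_map fc.
Let psi (K : nat) := log_deriv f K%:R.

Lemma log_deriv_homo x (K K' : R) : K <= K' -> log_deriv f K' x <= log_deriv f K x.
Proof.
move=> KK; rewrite ler_ln ?posrE ?max_expR_gt0//.
by rewrite ge_max !le_max lexx /= ler_expR lerN2 KK orbT.
Qed.

Lemma log_deriv_cvg x (a : R) :
  (a - psi K x)%:E @[K --> \oo] --> (a%:E - lne `|Df x|%:E)%E.
Proof.
have [Dx|Dx] := eqVneq (Df x) 0.
  rewrite Dx normr0 /= lexx /=.
  have psiE K : psi K x = - K%:R.
    by rewrite /psi /log_deriv Dx normr0 max_r ?expR_ge0// expRK.
  apply/cvgeryP; apply/cvgryPge => A.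
  exists (Num.truncn (A - a)).+1 => // K /= AK; rewrite psiE opprK.
  rewrite -lerBlDl ltW//; apply: lt_le_trans (truncnS_gt _) _.
  by rewrite ler_nat.
have D0 : 0 < `|Df x| by rewrite normr_gt0.
rewrite lne_EFin// -EFinB; apply: cvg_near_cst.
exists (Num.truncn (- ln `|Df x|)).+1 => // K /= AK; congr (a - _)%:E.
apply: log_deriv_eq; rewrite -[leRHS]lnK ?posrE// ler_expR lerNl ltW//.
by apply: lt_le_trans (truncnS_gt _) _; rewrite ler_nat.
Qed.

(** log |Df| is bounded above only; its defect below an upper bound [a] is a
    nonnegative function, to which monotone convergence applies. *)
Definition log_defect (a : R) x : \bar R := (a%:E - lne `|Df x|%:E)%E.

Lemma log_defect_ge0 a x : 0 <= a -> `|Df x| <= expR a -> (0 <= log_defect a x)%E.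
Proof.
move=> a0 Da; apply: (cvge_ge _ (@log_deriv_cvg x a)); apply: nearW => K.
rewrite lee_fin subr_ge0 -[leRHS]expRK.
by apply: log_deriv_le => //; rewrite -expR0 ler_expR.
Qed.

Lemma measurable_log_defect a : measurable_fun setT (log_defect a).
Proof.
apply: (@emeasurable_fun_cvg _ _ _ setT (fun K x => (a - psi K x)%:E)) => [K|x _].
  apply/measurable_EFinP; apply: measurable_funB => //.
  by apply: continuous_measurable; exact: log_deriv_continuous.
exact: log_deriv_cvg.
Qed.

Lemma lyapunov_defect (a : R) (nu : M R) : 0 <= a -> (forall x, `|Df x| <= expR a) ->
  (\int[(nu : probability _ _)]_x log_defect a x < +oo)%E ->
  lyapunov f nu = (a%:E - \int[(nu : probability _ _)]_x log_defect a x)%E.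
Proof.
move=> a0 Da wlt; set P := (nu : probability _ _) in wlt *.
have iw : P.-integrable setT (log_defect a).
  apply/integrableP; split; first exact: measurable_log_defect.
  by under eq_integral do rewrite gee0_abs ?log_defect_ge0//.
have ic : P.-integrable setT (fun=> a%:E) by apply: (bmeas_integrable P (bmeas_cst _ a)).
rewrite /lyapunov (eq_integral (fun x => a%:E - log_defect a x)%E).
  by rewrite integralB// integral_cst//= probability_setT mule1.
move=> x _; rewrite /log_defect; case: (lne _) => [r||]//.
by rewrite -!EFinB; congr EFin; lra.
Qed.

Section invariant.
Variable nu : M R.
Hypothesis nuinv : invariant_measure f nu.
Local Notation P := (nu : probability (X R) R).

(** Monotone convergence along K, which also covers a priori the possibility that
    log |Df| is not integrable: the bound on the integrals of the truncations
    makes the defect integrable. *)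
Lemma le_lyapunov (h : R) : (forall K, h <= \int[P]_x psi K x) ->
  (h%:E <= lyapunov f nu)%E.
Proof.
move=> hpsi; have [L L1 [DL _]] := C1_lipschitz fC1.
pose a := ln L; have a0 : 0 <= a by exact: ln_ge0.
have Da x : `|Df x| <= expR a by rewrite lnK// posrE (lt_le_trans ltr01).
pose v K x : \bar R := (a - psi K x)%:E.
have bpsi K : bmeas (psi K) by apply: continuous_bmeas; apply: log_deriv_continuous.
have bv K : bmeas (fun x => a - psi K x) by apply: bmeasB => //; exact: bmeas_cst.
have mv K : measurable_fun setT (v K) by apply/measurable_EFinP; have [] := bv K.
have v0 K x : (0 <= v K x)%E.
  by rewrite lee_fin subr_ge0; apply: log_deriv_le.
have vw : (\int[P]_x v K x)%E @[K --> \oo] --> (\int[P]_x log_defect a x)%E.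
  have := @cvg_monotone_convergence _ _ _ P setT measurableT v mv.
  rewrite (_ : (fun x => limn (v ^~ x)) = log_defect a).
    apply=> // x _ K K' KK; rewrite lee_fin lerD2l lerN2.
    by apply: log_deriv_homo; rewrite ler_nat.
  by apply/funext => x; apply/cvg_lim => //; exact: log_deriv_cvg.
have Ew : (\int[P]_x log_defect a x <= (a - h)%:E)%E.
  apply: (cvge_le _ vw).
  apply: nearW => K.
  have -> : (\int[P]_x v K x)%E = (\int[P]_x (a - psi K x))%:E.
    by rewrite /Rintegral fineK//; apply: integrable_fin_num => //; exact: bmeas_integrable.
  by rewrite lee_fin prob_intB ?prob_int_cst ?lerD2l ?lerN2//; exact: bmeas_cst.
have wlt := le_lt_trans Ew (ltry _).
have w0 : (0 <= \int[P]_x log_defect a x)%E.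
  by apply: integral_ge0 => x _; exact: log_defect_ge0.
rewrite (lyapunov_defect a0 Da)//; move: Ew.
rewrite -(@fineK _ (\int[P]_x log_defect a x)%E) ?ge0_fin_numE// -EFinB !lee_fin; lra.
Qed.

Lemma refinement_entropy_ge0 k (xi : X R -> 'I_k) n :
  (forall i, measurable (xi @^-1` [set i])) -> 0 <= refinement_entropy f nu xi n.
Proof.
move=> mxi.
rewrite /refinement_entropy -sumrN; apply: sumr_ge0 => w _ /=.
rewrite -mulrN mulr_ge0 ?fine_ge0//.
have mA := measurable_atom fC1 mxi w.
by rewrite oppr_ge0 ln_le0// -lee_fin fineK ?fin_num_measure// probability_le1.
Qed.

Lemma partition_entropy_ge0 k (xi : X R -> 'I_k) :
  (forall i, measurable (xi @^-1` [set i])) -> (0 <= partition_entropy f nu xi)%E.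
Proof.
move=> mxi; rewrite /partition_entropy.
have [cv|/dvgP->] := pselect (cvgn (fun n => (refinement_entropy f nu xi n / n%:R)%:E)).
  apply: lime_ge => //; apply: nearW => n.
  by rewrite lee_fin divr_ge0//; exact: refinement_entropy_ge0.
by [].
Qed.

Lemma entropy_ge0 : (0 <= entropy f nu)%E.
Proof.
pose xi0 (x : X R) : 'I_1 := ord0.
have mxi0 i : measurable (xi0 @^-1` [set i]).
  rewrite (_ : _ @^-1` _ = setT)//; apply/seteqP; split=> // x _ /=.
  by rewrite /xi0 (ord1 i).
apply: le_trans (partition_entropy_ge0 mxi0) _.
by apply: ereal_sup_ubound; exists 1%N, xi0.
Qed.

(** Only one large [n] is needed for each [d], so that this applies both to the
    limit of the normalized entropies and, with h = 0, when no such limit is at hand. *)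
Lemma lyapunov_ge_ratio k (xi : X R -> 'I_k) (h : R) :
  (forall i, measurable (xi @^-1` [set i])) ->
  (forall d : R, 0 < d -> exists2 n, d^-1 <= n%:R &
    (0 < n)%N && (n%:R * (h - d) <= refinement_entropy f nu xi n)) ->
  (h%:E <= lyapunov f nu)%E.
Proof.
move=> mxi hn; apply: le_lyapunov => K; rewrite -subr_ge0; apply/ler_addgt0Pr => e e0.
have e40 : 0 < e / 4 by rewrite divr_gt0.
have [C HC] := refinement_entropy_le fC1 fex nuinv mxi
  (log_deriv_continuous fC1 (K := K%:R)) e40 (log_deriv_ge f K%:R).
have [d [d0 d1 dC]] : exists d : R, [/\ 0 < d, d <= e / 4 & d * `|C| <= e / 4].
  exists (Num.min (e / 4) (e / 4 / (`|C| + 1))).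
  have C0 : 0 < `|C| + 1 by rewrite ltr_wpDl.
  rewrite lt_min e40 divr_gt0//; split=> //; first by rewrite ge_min lexx.
  apply: (@le_trans _ _ (e / 4 / (`|C| + 1) * `|C|)).
    by rewrite ler_wpM2r// ge_min lexx orbT.
  by rewrite -mulrA ler_piMr ?ltW// mulrC ltr_pdivrMr// mul1r ltrDl.
have [n dn /andP[n0 hR]] := hn d d0.
have nR : 0 < n%:R :> R by rewrite ltr0n.
have Cn : C <= n%:R * (e / 4).
  apply: le_trans (ler_norm _) _; rewrite mulrC -ler_pdivrMr//.
  have : n%:R^-1 <= d by rewrite -[d]invrK lef_pV2 ?posrE ?invr_gt0.
  move=> /(ler_wpM2r (normr_ge0 C)); rewrite mulrC; lra.
have := le_trans hR (HC n); rewrite -/(psi K).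
have -> : C + n%:R * (\int[P]_x psi K x + e / 4) =
  C - n%:R * (e / 4) + n%:R * (\int[P]_x psi K x + e / 2) by field.
move=> H; have : n%:R * (h - d) <= n%:R * (\int[P]_x psi K x + e / 2) by lra.
rewrite ler_pM2l//; lra.
Qed.

Theorem ruelle_inequality : (entropy f nu <= lyapunov f nu)%E.
Proof.
(* the default value of a divergent limit is 0 *)
have L0 k (xi : X R -> 'I_k) : (forall i, measurable (xi @^-1` [set i])) ->
    (0 <= lyapunov f nu)%E.
  move=> mxi; apply: (lyapunov_ge_ratio mxi) => d d0.
  exists (Num.truncn d^-1).+1; first by rewrite ltW// truncnS_gt.
  rewrite /= (le_trans _ (refinement_entropy_ge0 _ mxi))//.
  by rewrite mulr_ge0_le0// sub0r oppr_le0 ltW.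
apply: ge_ereal_sup => _ [k [xi [mxi ->]]]; rewrite /partition_entropy.
set u := (fun n => _); have [cv|/dvgP->] := pselect (cvgn u); last exact: L0 mxi.
have h_le (h : R) : (h%:E <= limn u)%E -> (h%:E <= lyapunov f nu)%E.
  move=> hu; apply: (lyapunov_ge_ratio mxi) => d d0; apply: contrapT => nh.
  suff : (limn u <= (h - d)%:E)%E.
    by move=> /(le_trans hu); rewrite lee_fin; lra.
  apply: lime_le => //; exists (Num.truncn d^-1).+1 => // n /= dn.
  have n0 : (0 < n)%N by apply: leq_trans dn.
  rewrite lee_fin leNgt; apply/negP => /ltW; rewrite ler_pdivlMr ?ltr0n// mulrC => hn.
  apply: nh; exists n; last by rewrite n0.
  by rewrite ltW//; apply: lt_le_trans (truncnS_gt _) _; rewrite ler_nat.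
have := partition_entropy_ge0 mxi; rewrite /partition_entropy -/u.
case E : (limn u) => [h| |] // _; first by apply: h_le; rewrite E.
by rewrite (_ : lyapunov f nu = +oo%E)//; apply/eqyP => A _; apply: h_le; rewrite E leey.
Qed.

Lemma free_energy_le0 : (free_energy f nu <= 0)%E.
Proof. by rewrite /free_energy; case: ifP => // _; rewrite sube_le0 ruelle_inequality. Qed.

End invariant.
End ruelle_inequality.

(** * Periodic orbits shadowing the critical orbit *)

Section critical_orbit.
Variables (R : realType) (f : X R -> X R) (c : X R).
Hypotheses (fc : continuous f) (fex : topologically_exact f).
Hypothesis cnr : non_recurrent f c.

(** Non-recurrence keeps all late iterates away from [c]; an early return to [c]
    itself would make [c] periodic and hence recurrent. *)
Lemma critical_gap : exists2 d : R, 0 < d &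
  forall i, (0 < i)%N -> d <= `|toR c - toR (iter i f c)|.
Proof.
have [d [d0 [N HN]]] : exists d : R, 0 < d /\ exists N, forall n, (N <= n)%N ->
    d <= `|toR c - toR (iter n f c)|.
  apply: contrapT => H; apply: cnr => A B [N _ NA] /nbhs_toRP[d d0 dB].
  have [n Nn cn] : exists2 n, (N <= n)%N & `|toR c - toR (iter n f c)| < d.
    apply: contrapT => H'; apply: H; exists d; split=> //; exists N => n Nn.
    by rewrite leNgt; apply/negP => cn; apply: H'; exists n.
  by exists (iter n f c); split; [exact: NA|exact: dB].
have cn i : (0 < i)%N -> iter i f c <> c.
  move=> i0 ci; have ck k : iter (k * i) f c = c.
    by elim: k => [//|k IHk]; rewrite mulSn iterD IHk.
  have := HN (N * i)%N (leq_pmulr _ i0).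
  by rewrite ck subrr normr0 leNgt d0.
exists (\big[Num.min/d]_(i < N) `|toR c - toR (iter i.+1 f c)|).
  apply: lt_bigmin => // i _; rewrite normr_gt0 subr_eq0.
  by apply/eqP => /toR_inj/esym; exact: cn.
move=> [//|i] _; have [iN|Ni] := ltnP i N.
  exact: (@bigmin_le _ _ _ _ (Ordinal iN)).
by apply: le_trans (HN i.+1 _); [exact: bigmin_le_id|exact: leqW].
Qed.

(** The Bowen interval of [c] for m steps is mapped onto X by f^(m + N), which
    therefore has a fixed point in it. Well before time m the shadowing is
    closer than any given e', since an image of length e' would cover X before
    time m, whereas all images up to time m are e-small with e < 1/2. The
    interval is taken on the right of [c], so that x - c > 0 in the study of
    the flat critical point. *)
Lemma shadowing_periodic (e : R) : 0 < e -> e < 1 / 2 -> e <= 1 - toR c ->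
  exists N (p : nat -> X R),
  [/\ forall m, toR c <= toR (p m),
      forall m, iter (m + N) f (p m) = p m,
      forall m i, (i <= m)%N -> `|toR (iter i f c) - toR (iter i f (p m))| <= e &
      forall e' : R, 0 < e' -> exists N', forall m i, (i + N' <= m)%N ->
        `|toR (iter i f c) - toR (iter i f (p m))| < e'].
Proof.
move=> e0 e2 ec; have [N HN] := exact_spread fc fex e0; exists N.
have cz : e <= `|toR c - toR (to_X (1 : R))|.
  by rewrite to_XK ?ler01 ?lexx// distrC (le_trans ec)// ler_norm.
have hp m : exists p, [/\ toR c <= toR p, iter (m + N) f p = p &
    forall s, between c p s -> forall i, (i <= m)%N ->
      `|toR (iter i f c) - toR (iter i f s)| <= e].
  have [y [czy ys [i im yi]]] := bowen_interval fc m (ltW e0) cz.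
  have cy : toR c <= toR y.
    have := toR_itv c; move/between_cases: czy; rewrite to_XK ?ler01 ?lexx//; lra.
  have iN : (i + N <= m + N)%N by rewrite leq_add2r.
  have ei : e <= `|toR (iter i f c) - toR (iter i f y)| by rewrite yi.
  have [s0 cs0 Es0] := HN i c y ei _ iN c.
  have [s1 cs1 Es1] := HN i c y ei _ iN y.
  pose g s := toR (iter (m + N) f s) - toR s.
  have gc : continuous g.
    move=> s; apply: (cvgB _ (@toR_continuous R s)).
    apply: (@continuous_comp _ _ _ (iter (m + N) f) (@toR R)).
      exact: continuous_iter.
    exact: toR_continuous.
  have g0 : g s0 <= 0.
    by rewrite /g Es0; have := between_cases cs0; lra.
  have g1 : 0 <= g s1.
    by rewrite /g Es1; have := between_cases cs1; lra.
  have [|p sp /eqP] := @X_IVT R g s0 s1 0 gc.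
    by rewrite ge_min g0 le_max g1 orbT.
  rewrite subr_eq0 => /eqP/toR_inj pE.
  have cyp := between_sub cs0 cs1 sp.
  exists p; split=> // [|s cps]; first by have := between_cases cyp; lra.
  by apply: ys; apply: between_trans cyp cps.
have /choice[p pP] := hp; exists p; split.
- by move=> m; have [] := pP m.
- by move=> m; have [] := pP m.
- by move=> m i im; have [_ _ /(_ _ (betweenr _ _) i im)] := pP m.
move=> e' e'0; have [N' HN'] := exact_spread fc fex e'0; exists N' => m i iNm.
have [_ _ ps] := pP m.
rewrite ltNge; apply/negP => /HN'/(_ _ (leqnn _)) H.
have [s0 cs0 E0] := H (to_X 0); have [s1 cs1 E1] := H (to_X 1).
have := ps _ cs0 _ iNm; have := ps _ cs1 _ iNm.
by rewrite E0 E1 !to_XK ?ler01 ?lexx// !ler_norml; lra.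
Qed.

End critical_orbit.

Lemma subSn_lt a m : (a.+1 - m = a - m + (m < a.+1))%N.
Proof. by case: ltnP => am; [rewrite addn1 subSn|lia]. Qed.

Lemma le_addr_norm (R : realType) (a b u w : R) : `|a| <= u -> `|b| <= u ->
  0 <= w -> a <= b + w + 2 * u.
Proof.
move=> /ler_normlP[_ au] /ler_normlP[bu _] w0.
by rewrite (le_trans au)// mulr_natl mulr2n; lra.
Qed.

Section periodic_derivative.
Variables (R : realType) (f : X R -> X R) (c : X R).
Hypotheses (fC1 : class_C 1 setT (toR \o f)) (fex : topologically_exact f).
Hypothesis cnr : non_recurrent f c.
Local Notation Df := (D (toR \o f)).
Hypothesis Dc : [set x | Df x = 0] = [set c].
Hypothesis c01 : 0 < toR c < 1.
Hypothesis flatness : exists2 r : R, 0 < r & forall w : R, 0 < w -> exists B : R,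
  forall x, toR c < toR x < toR c + r -> 
    ln `|Df x| <= (1 - w) * ln `|toR (f x) - toR (f c)| + B.

Let fc := C1_continuous fC1.

Lemma D_neq0 x : x <> c -> 0 < `|Df x|.
Proof.
move=> xc; rewrite normr_gt0; apply/eqP => Dx.
by apply: xc; have : [set x | Df x = 0] x by []; rewrite Dc.
Qed.

(** Compactness: max(|Df x|, d - |c - x|) is continuous and never vanishes. *)
Lemma D_away (d : R) : 0 < d -> exists K : R, forall x, d <= `|toR c - toR x| ->
  expR (- K) <= `|Df x|.
Proof.
move=> d0.
pose g x := (Num.max `|Df x| (d - `|toR c - toR x|))^-1.
have h0 x : 0 < Num.max `|Df x| (d - `|toR c - toR x|).
  rewrite lt_max; have [->|/eqP/D_neq0->//] := eqVneq x c.
  by rewrite subrr normr0 subr0 d0 orbT.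
have gc : continuous g.
  move=> x.
  have c1 : {for x, continuous (fun x => `|Df x|)}.
    exact: (cvg_norm (@C1_D_continuous _ _ fC1 x)).
  have c2 : {for x, continuous (fun x => d - `|toR c - toR x|)}.
    exact: (cvgB (cvg_cst _) (cvg_norm (cvgB (cvg_cst _) (@toR_continuous R x)))).
  exact: (cvgV (lt0r_neq0 (h0 x)) (continuous_max c1 c2)).
have [B B0 gB] := X_bounded gc.
exists (ln B) => x dx; rewrite -lnV ?posrE// lnK ?posrE ?invr_gt0//.
have := gB x; rewrite /g max_l; last by rewrite (@le_trans _ _ 0) ?subr_le0.
have D0 : 0 < `|Df x|.
  by apply: D_neq0 => xc; move: dx; rewrite xc subrr normr0 leNgt d0.
by rewrite ger0_norm ?invr_ge0// => H; rewrite -[leRHS]invrK lef_pV2 ?posrE ?invr_gt0.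
Qed.

(** During the shadowing time the distance to the critical orbit grows from
    |f p - f c| to at most 1, and log |Df| is almost the logarithmic growth rate
    of that distance, because the critical orbit stays away from [c]; the
    contributions add up to about - ln |f p - f c|, which the single passage near
    [c] compensates by flatness. *)
Lemma slow_periodic_orbits : exists N (p : nat -> X R),
  [/\ forall m, iter (m + N) f (p m) = p m,
      forall e' : R, 0 < e' -> exists N', forall m i, (i + N' <= m)%N ->
        `|toR (iter i f c) - toR (iter i f (p m))| < e',
      forall m i, (0 < m)%N -> 0 < `|Df (iter i f (p m))| &
      forall w : R, 0 < w -> exists C : R, forall m, (0 < m)%N ->
        \sum_(i < m + N) ln `|Df (iter i f (p m))| <= w * (m + N)%:R + C].
Proof.
have [d d0 gap] := critical_gap cnr.
have [r r0 flat_r] := flatness.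
have [L L1 [DL fL]] := C1_lipschitz fC1.
have L0 : 0 < L by exact: lt_le_trans L1.
have lnL0 : 0 <= ln L by exact: ln_ge0.
have [e [e0 e2 ec ed er]] : exists e : R,
    [/\ 0 < e, e < 1 / 2, e <= 1 - toR c, e <= d / 2 & e < r].
  exists (Num.min (Num.min (1 / 4) (1 - toR c)) (Num.min (d / 2) (r / 2))).
  rewrite !lt_min !gt_min !ge_min !lexx !orbT; split=> //.
  - by rewrite !divr_gt0// subr_gt0; have /andP[_ ->] := c01.
  - by apply/orP; left; apply/orP; left; lra.
  - by apply/orP; right; apply/orP; right; lra.
have [N [p [cp pper pe pe']]] := shadowing_periodic fc fex e0 e2 ec.
exists N, p.
have pP m i : (0 < m)%N -> iter i f (p m) <> c.
  move=> m0 pc; have := gap (m + N)%N (ltn_addr _ m0).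
  by rewrite -{2}pc -iterD addnC iterD pper pc subrr normr0 leNgt d0.
have pD m i : (0 < m)%N -> 0 < `|Df (iter i f (p m))|.
  by move=> m0; apply: D_neq0; exact: pP.
split=> // w w0.
have [K HK] := D_away (divr_gt0 d0 (ltr0Sn R 1)).
pose psi := log_deriv f K.
have psic : continuous psi by exact: log_deriv_continuous.
have [B B0 psiB] := X_bounded psic.
(* w1 is spent twice: once per step, and once on - ln (dist 1) <= n ln L + C0 *)
pose w1 := w / (2 * (1 + ln L)).
have w10 : 0 < w1 by rewrite divr_gt0// mulr_gt0// ltr_pwDl.
have ww1 : w1 * (1 + ln L) = w / 2.
  have lnL1 : 1 + ln L != 0 by apply: lt0r_neq0; lra.
  by rewrite /w1; field.
have [e' e'0 psie] := X_unif_continuous psic w10.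
have [N' HN'] := pe' e' e'0.
have [B' HB'] := flat_r w1 w10.
pose C0 := ln (2 / d).
exists (w1 * C0 + B' + N'%:R * (2 * B) + N%:R * B) => m m0.
pose n := (m + N)%N; have n0 : (0 < n)%N by rewrite ltn_addr.
pose dist i := `|toR (iter i f (p m)) - toR (iter i f c)|.
(* p returns to itself at time n while the critical orbit is away from c then, so
   the two orbits have separated and p is not too close to c *)
have dn : d / 2 <= dist n.
  have := gap n n0; rewrite /dist pper.
  have := pe m 0%N (leq0n _); rewrite /=.
  have := ler_distD (toR (p m)) (toR c) (toR (iter n f c)); lra.
have dist0 i : (i <= n)%N -> 0 < dist i.
  move=> ni; rewrite lt_neqAle normr_ge0 andbT eq_sym normr_eq0 subr_eq0.
  apply/eqP => /toR_inj E; move: dn.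
  by rewrite /dist -(subnK ni) !iterD E subrr normr0 leNgt divr_gt0.
have d1 : ln (dist 1) >= - C0 - n%:R * ln L.
  have : dist n <= L ^+ n * dist 1.
    rewrite /dist -(subnK n0) addn1 !iterSr subn1.
    apply: le_trans (fL _ _ _) _; rewrite ler_wpM2r// exprS.
    by rewrite ler_peMl ?exprn_ge0// ltW.
  move=> /(le_trans dn) h.
  have : ln (d / 2) <= ln (L ^+ n * dist 1).
    by rewrite ler_ln// posrE ?divr_gt0// mulr_gt0 ?exprn_gt0 ?dist0.
  rewrite [ln (L ^+ n * _)]lnM ?posrE ?exprn_gt0 ?dist0// lnXn// -[ln L *+ n]mulr_natl.
  by rewrite /C0 -[2 / d]invf_div lnV ?posrE ?divr_gt0//; lra.
have first_step : ln `|Df (p m)| <= (1 - w1) * ln (dist 1) + B'.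
  apply: HB'; rewrite lt_neqAle cp andbT; apply/andP; split.
    by apply/eqP => /toR_inj/esym; apply: (@pP m 0%N m0).
  have := pe m 0%N (leq0n _); rewrite /= distrC; have := ler_norm (toR (p m) - toR c); lra.
(* the last N' steps before time m, where shadowing is coarse, cost at most 2 B each *)
have step i : (0 < i)%N -> (i < m)%N -> ln `|Df (iter i f (p m))| <=
    ln (dist i.+1) - ln (dist i) + w1 + (m < i + N')%:R * (2 * B).
  move=> i0 im; have im' : (i <= n)%N by rewrite ltnW// ltn_addr.
  have im'' : (i.+1 <= n)%N by rewrite ltn_addr.
  have [z pcz Ez] := slope fC1 (iter i f (p m)) (iter i f c).
  have near_p u : between (iter i f (p m)) (iter i f c) u ->
      expR (- K) <= `|Df u| /\ `|toR (iter i f (p m)) - toR u| <= dist i.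
    move=> pcu; split; last exact: (between_dist (betweenl _ _) pcu).
    apply: HK; have := between_dist (betweenr _ _) pcu.
    have := pe m i (ltnW im); rewrite distrC.
    have := gap i i0; have := ler_distD (toR u) (toR c) (toR (iter i f c)).
    by rewrite (distrC (toR u)); lra.
  have [Dz zd] := near_p z pcz.
  have [Dp _] := near_p _ (betweenl _ _).
  have -> : ln (dist i.+1) = psi z + ln (dist i).
    rewrite /dist !iterS Ez lnM ?posrE ?(lt_le_trans (expR_gt0 _) Dz)//; last exact: dist0.
    by rewrite /psi log_deriv_eq.
  rewrite addrK -(log_deriv_eq Dp) -/psi.
  case: ltnP => [_|iN'] /=.
    by rewrite mul1r; apply: le_addr_norm => //; exact: ltW.
  rewrite mul0r addr0; have := psie (iter i f (p m)) z.
  have -> : `|toR (iter i f (p m)) - toR z| <= e'.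
    by apply: le_trans zd _; rewrite /dist distrC ltW//; exact: HN'.
  by move=> /(_ isT) h; rewrite -lerBlDl; apply: le_trans h; exact: ler_norm.
have psiln x : ln `|Df x| <= psi x \/ x = c.
  have [->|/eqP/D_neq0 Dx] := eqVneq x c; [by right|left].
  by rewrite ler_ln ?posrE ?max_expR_gt0// le_max lexx.
have telescope j : (j < m)%N -> \sum_(1 <= i < j.+1) ln `|Df (iter i f (p m))| <=
    ln (dist j.+1) - ln (dist 1) + j%:R * w1 + (j + N' - m)%:R * (2 * B).
  elim: j => [|j IHj] jm.
    by rewrite big_geq// subrr !add0r mul0r add0r mulr_ge0// mulr_ge0// ltW.
  rewrite big_nat_recr//=; apply: le_trans (lerD (IHj (ltnW jm)) (step j.+1 isT jm)) _.
  rewrite -[j.+1%:R]natr1.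
  have -> : (j.+1 + N' - m)%:R = (j + N' - m)%:R + (m < j.+1 + N')%:R :> R.
    by rewrite addSn subSn_lt natrD.
  by rewrite le_eqVlt; apply/orP; left; apply/eqP; ring.
have tail : \sum_(m <= i < n) ln `|Df (iter i f (p m))| <= N%:R * B.
  have -> : N%:R * B = \sum_(m <= i < n) B.
    have nm : (n - m)%N = N by rewrite /n addKn.
    by rewrite sumr_const_nat nm; exact: mulr_natl.
  apply: ler_sum => i _; have [h|/(pP _ _ m0)//] := psiln (iter i f (p m)).
  by apply: le_trans h (le_trans (ler_norm _) (psiB _)).
have bulk : \sum_(1 <= i < m) ln `|Df (iter i f (p m))| <=
    - ln (dist 1) + m%:R * w1 + N'%:R * (2 * B).
  have mm : (m.-1 < m)%N by rewrite prednK.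
  have := telescope m.-1 mm; rewrite prednK//.
  have lnm : ln (dist m) <= 0.
    apply: ln_le0; have /andP[? ?] := toR_itv (iter m f (p m)).
    by have /andP[? ?] := toR_itv (iter m f c); rewrite /dist ler_norml; lra.
  have w1m : m.-1%:R * w1 <= m%:R * w1.
    by rewrite ler_wpM2r ?(ltW w10)// ler_nat leq_pred.
  have NB : (m.-1 + N' - m)%:R * (2 * B) <= N'%:R * (2 * B).
    by rewrite ler_wpM2r ?mulr_ge0// ?(ltW B0)// ler_nat leq_subLR leq_add2r leq_pred.
  move=> /le_trans; apply; rewrite lerD// lerD//.
  by rewrite -[leRHS]add0r lerD2r.
rewrite -(big_mkord xpredT (fun i => ln `|Df (iter i f (p m))|)).
rewrite (@big_cat_nat _ _ _ m)//=; last exact: leq_addr.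
rewrite (@big_cat_nat _ _ _ 1)//= big_nat1 /=.
rewrite addrA -/n.
apply: le_trans (lerD (lerD first_step bulk) tail) _.
have -> : (1 - w1) * ln (dist 1) + B' + (- ln (dist 1) + m%:R * w1 + N'%:R * (2 * B))
    + N%:R * B =
  - w1 * ln (dist 1) + m%:R * w1 + (B' + N'%:R * (2 * B) + N%:R * B) by ring.
rewrite [leRHS](_ : _ =
  w * n%:R + w1 * C0 + (B' + N'%:R * (2 * B) + N%:R * B)); last by rewrite /n; ring.
rewrite lerD2r; apply: (@le_trans _ _ (w1 * (C0 + n%:R * ln L) + n%:R * w1)).
  apply: lerD; last by rewrite ler_wpM2r ?(ltW w10)// ler_nat leq_addr.
  by rewrite mulNr -mulrN ler_wpM2l ?(ltW w10)// lerNl opprD.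
have -> : w1 * (C0 + n%:R * ln L) + n%:R * w1 = w1 * (1 + ln L) * n%:R + w1 * C0.
  by ring.
by rewrite lerD2r ww1 ler_wpM2r// ler_pdivrMr// ler_peMr ?ler1n// ltW.
Qed.

End periodic_derivative.

(** * The flat critical point *)

Section flatness.
Variable R : realType.

Lemma half_le_double (a b : R) : 0 < a -> `|a - b| <= a / 2 -> a / 2 <= b <= 2 * a.
Proof. by rewrite ler_norml; lra. Qed.

Lemma C1_line_bound (g : R -> R) (a : R) : C1_line g -> exists2 k : R, 0 < k &
  forall t, `|t - a| <= 1 -> `|derive1 g t| <= k /\ `|g t - g a| <= k * `|t - a|.
Proof.
move=> [gd gc].
have /compact_bounded[B [_ gB]] : compact (derive1 g @` `[a - 1, a + 1]).
  apply: continuous_compact; last exact: segment_compact.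
  exact: continuous_subspaceT.
pose k := `|B| + 1; have k0 : 0 < k by rewrite ltr_wpDl.
have gk t : `|t - a| <= 1 -> `|derive1 g t| <= k.
  move=> ta; apply: (gB k); first by rewrite /k (le_lt_trans (ler_norm B))// ltrDl.
  by exists t => //=; rewrite in_itv /=; move: ta; rewrite ler_norml; lra.
exists k => // t ta; split; first exact: gk.
have gcont : continuous g by move=> x; apply/differentiable_continuous/derivable1_diffP/gd.
have mvt (u w : R) : u <= w -> `|u - a| <= 1 -> `|w - a| <= 1 ->
    `|g w - g u| <= k * `|w - u|.
  move=> uw ua wa; have [x xuw||z zuw ->] := @MVT_segment R g (derive1 g) u w uw.
  - by rewrite derive1E; apply: derivableP; exact: gd.
  - exact: continuous_subspaceT.
  rewrite normrM ler_wpM2r//; apply: gk; move: zuw ua wa.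
  by rewrite in_itv /= !ler_norml; lra.
have a1 : `|a - a| <= 1 by rewrite subrr normr0.
have [|/ltW] := leP a t => at_; first exact: mvt.
by rewrite distrC (distrC t); exact: mvt.
Qed.

(** The tangent inequality exp(a) (1 + v s - a) <= exp(v s) at the point a where the
    slopes in s agree. *)
Lemma linear_le_exp (q w v s : R) : 0 < q -> 0 < w -> 0 < v ->
  q * s <= w * expR (v * s) + q / v * (ln (q / (w * v)) - 1).
Proof.
move=> q0 w0 v0; have wv : 0 < w * v by rewrite mulr_gt0.
pose a := ln (q / (w * v)).
have ea : expR a = q / (w * v) by rewrite lnK// posrE divr_gt0.
have : expR a * (1 + (v * s - a)) <= expR (v * s).
  have -> : v * s = a + (v * s - a) by lra.
  by rewrite expRD ler_pM2l ?expR_gt0// [a + _]addrC subrK expR_ge1Dx.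
rewrite -(ler_pM2l w0) ea -/a => H.
have -> : q * s = w * (q / (w * v) * (1 + (v * s - a))) + q / v * (a - 1).
  by field; rewrite !gt_eqF.
by rewrite lerD2r.
Qed.

(** With s = - ln d and l = ln |xi|, the left-hand side is the absolute value of the
    derivative of d^(- v) ln |xi|; each factor is at most a constant times a
    power of 1/d = exp(s). *)
Lemma flat_log_derivative (s v dv l xi dxi kxi kg W v0 v1 : R) :
  0 <= s -> 0 < v0 -> v0 <= v <= v1 -> `|dv| <= W -> `|l| <= kg * expR s ->
  `|dxi| <= kxi -> `|xi|^-1 <= kg * expR s -> 0 <= kg ->
  `|expR (v * s) * (dxi / xi) + l * (expR (v * s) * - (v * expR s - s * dv))| <=
  (v1 + W + kxi) * kg * expR ((v1 + 2) * s).
Proof.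
move=> s0 v00 /andP[vv0 vv1] dvW lk dxik xik kg0.
have e1 : 1 <= expR s by rewrite -expR0 ler_expR.
have se : s <= expR s by rewrite (le_trans _ (expR_ge1Dx s))// lerDr.
have v0' : 0 <= v by rewrite (le_trans _ vv0)// ltW.
have kes : 0 <= kg * expR s by rewrite mulr_ge0 ?expR_ge0.
have -> : (v1 + W + kxi) * kg * expR ((v1 + 2) * s) =
    expR (v1 * s) * ((kxi * (kg * expR s)) * expR s + (kg * expR s) * ((v1 + W) * expR s)).
  have -> : (v1 + 2) * s = v1 * s + s + s by ring.
  by rewrite !expRD; ring.
have -> : expR (v * s) * (dxi / xi) + l * (expR (v * s) * - (v * expR s - s * dv)) =
    expR (v * s) * (dxi / xi + l * - (v * expR s - s * dv)) by ring.
rewrite normrM gtr0_norm ?expR_gt0//; apply: ler_pM; rewrite ?expR_ge0//.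
  by rewrite ler_expR ler_wpM2r.
apply: le_trans (ler_normD _ _) _; apply: lerD.
  rewrite normrM normfV; apply: (@le_trans _ _ (kxi * (kg * expR s))).
    by apply: ler_pM => //; rewrite invr_ge0.
  by rewrite ler_peMr// mulr_ge0// (le_trans _ dxik).
rewrite normrM; apply: ler_pM => //.
rewrite normrN; apply: le_trans (ler_normB _ _) _; rewrite mulrDl; apply: lerD.
  by rewrite normrM !ger0_norm ?expR_ge0// ler_wpM2r ?expR_ge0.
by rewrite mulrC normrM; apply: ler_pM => //; rewrite ger0_norm.
Qed.

Variables (f : X R -> X R) (c : X R) (ell : X R -> R).
Hypothesis fC1 : class_C 1 setT (toR \o f).
Local Notation Df := (D (toR \o f)).
Hypothesis Dc : [set x | Df x = 0] = [set c].
Hypothesis c01 : 0 < toR c < 1.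
Hypothesis fflat : flat_exponent f c ell.
Hypothesis fpol : polynomial_order c ell.

(** With d = x - c, the equation eta (f x) = |xi x|^(d^(- v x)) reads
    ln eta (f x) = d^(- v x) ln |xi x|. Its right-hand side goes to -oo faster than
    a power of 1/d, while its derivative grows at most like a power of 1/d; so
    |Df x| / |f x - f c| is subexponential in - ln |f x - f c|. *)
Lemma flat_derivative : exists2 r : R, 0 < r & forall w : R, 0 < w -> exists B : R,
  forall x, toR c < toR x < toR c + r ->
    ln `|Df x| <= (1 - w) * ln `|toR (f x) - toR (f c)| + B.
Proof.
have [v [vC1 vc vell]] := fpol.
have [_ _ _ [xi [eta [[xiC [g [gC xiK gK]]] [etaC [h [hC etaK hK]]] xic etac powE]]]] := fflat.
have vd x : differentiable_at v x by have [/(_ 0%N x) H _] := vC1; apply: H.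
have Dvc : continuous (D v) by move=> x; have [_ H] := vC1; apply: H.
have vcont : continuous v by move=> x; exact: differentiable_at_continuous.
have [W W0 DvW] := X_bounded Dvc.
have [kxi kxi0 xik] := C1_line_bound (toR c) xiC.
have [kg kg0 gk] := C1_line_bound 0 gC.
have [keta keta0 etak] := C1_line_bound (toR (f c)) etaC.
have [kh kh0 hk] := C1_line_bound 0 hC.
have g0 : g 0 = toR c by rewrite -xic xiK.
have h0 : h 0 = toR (f c) by rewrite -etac etaK.
pose v0 := v c / 2; pose v1 := 2 * v c.
have v00 : 0 < v0 by rewrite divr_gt0.
have [r1 r10 near1] : exists2 r1 : R, 0 < r1 & forall x, x != c -> `|toR c - toR x| < r1 ->
    `|xi (toR x)| `^ (ell x) = eta (toR (f x)) /\ ell x = `|toR x - toR c| `^ (- v x).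
  have /nbhs_toRP[d1 d10 H1] := powE.
  have /nbhs_toRP[d2 d20 H2] := vell.
  exists (Num.min d1 d2); first by rewrite lt_min d10.
  by move=> x xc; rewrite lt_min => /andP[x1 x2]; split; [exact: H1|exact: H2].
have [r2 r20 near2] : exists2 r2 : R, 0 < r2 & forall x, `|toR c - toR x| <= r2 ->
    `|v c - v x| <= v0.
  by have [r2 ? H] := X_unif_continuous vcont v00; exists r2 => // x; exact: H.
have [r [r0 rr1 rr2 rc rxi]] : exists r : R, [/\ 0 < r, r <= r1, r <= r2,
    toR c + r <= 1 & kxi * r <= expR (-1)].
  exists (Num.min (Num.min r1 r2) (Num.min (1 - toR c) (expR (-1) / kxi))).
  rewrite !lt_min r10 r20 subr_gt0 divr_gt0 ?expR_gt0//; have /andP[_ ->] := c01.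
  split=> //; rewrite ?ge_min ?lexx ?orbT//.
    by rewrite -lerBrDl !ge_min lexx !orbT.
  by rewrite mulrC -ler_pdivlMr// !ge_min lexx !orbT.
have c0 : 0 < toR c by have /andP[] := c01.
exists r => // w w0.
pose q := v1 + 2; have q0 : 0 < q by rewrite addr_gt0// mulr_gt0.
pose C := (v1 + W + kxi) * kg.
have C0 : 0 < C by rewrite mulr_gt0// !addr_gt0// mulr_gt0.
exists (ln (kh * keta * C) + (w * ln kh + q / v0 * (ln (q / (w * v0)) - 1))) => x /andP[cx xr].
set t := toR x in cx xr.
have t01 : 0 < t < 1 by lra.
have tx : to_X t = x by rewrite /t toRK.
have t_c : 0 < t - toR c by rewrite subr_gt0.
(* lam is ln |xi|, written so as to be differentiated without the absolute value *)
pose lam s := 2^-1 * ln (xi s * xi s).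
pose mu s := expR (- (v (to_X s) * ln (s - toR c))).
have xi0 s : toR c < s -> xi s != 0.
  move=> cs; apply/eqP => xis; have : g (xi s) = g 0 by rewrite xis.
  by rewrite xiK g0 => sc; move: cs; rewrite sc ltxx.
have lamE s : toR c < s -> lam s = ln `|xi s|.
  move=> cs; have xs : 0 < `|xi s| by rewrite normr_gt0 xi0.
  have -> : lam s = 2^-1 * ln (`|xi s| * `|xi s|).
    by rewrite -normrM ger0_norm// -expr2 sqr_ge0.
  by rewrite lnM ?posrE//; lra.
have eqE s : toR c < s < toR c + r -> eta (toR (f (to_X s))) = expR (mu s * lam s).
  move=> /andP[cs sr]; have sK : toR (to_X s) = s by apply: to_XK; lra.
  have sc : to_X s != c.
    by apply/eqP => sc; move: cs; rewrite -sc sK ltxx.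
  have [] := near1 (to_X s) sc.
    by rewrite sK ltr0_norm ?subr_lt0//; lra.
  rewrite sK => <- ->; rewrite [`|s - toR c|]gtr0_norm ?subr_gt0//.
  have n1 : (s - toR c == 0) = false by rewrite gt_eqF// subr_gt0.
  have n2 : (`|xi s| == 0) = false by rewrite normr_eq0; exact/negbTE/xi0.
  by rewrite lamE// /powR n1 n2 /mu mulNr.
(* f is recovered as h (exp (mu lam)), with h inverse to eta: in this form the
   derivative of f is bounded by local upper bounds on that of h *)
have G_near : \forall s \near t, h (expR (mu s * lam s)) = (toR \o f \o @to_X R) s.
  apply/nbhs_ballP; exists (Num.min (t - toR c) (toR c + r - t)) => /=.
    by rewrite lt_min t_c subr_gt0.
  move=> s; rewrite /ball /= lt_min !ltr_norml => /andP[s1 s2].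
  by rewrite -eqE ?etaK//; lra.
have d1 : is_derive t 1 (fun s : R => s - toR c) 1.
  by have := is_deriveB (is_derive_id t 1) (is_derive_cst (toR c) t 1); rewrite subr0.
have dlog : is_derive t 1 (fun s => ln (s - toR c)) (t - toR c)^-1.
  by have := @is_derive1_comp R (@ln R) _ t _ _ (is_derive1_ln t_c) d1; rewrite mulr1.
have dv : is_derive t 1 (v \o @to_X R) (D v x).
  by rewrite -tx; apply: is_derive_to_X => //; exact: vd.
have dmu : is_derive t 1 mu (mu t * - (v x * (t - toR c)^-1 + ln (t - toR c) * D v x)).
  have := @is_derive1_comp R expR _ t _ _ (is_derive_expR _) (is_deriveN (is_deriveM dv dlog)).
  by rewrite /= tx.
have dxi : is_derive t 1 xi (derive1 xi t).
  by rewrite derive1E; apply: derivableP; exact: xiC.1.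
have xit := xi0 t cx.
have xixi : 0 < xi t * xi t by rewrite -expr2 exprn_even_gt0.
have dlam : is_derive t 1 lam (derive1 xi t / xi t).
  have := is_deriveZ 2^-1 (@is_derive1_comp R (@ln R) _ t _ _
    (is_derive1_ln xixi) (is_deriveM dxi dxi)).
  by move=> H; apply: (is_derive_eq H); rewrite /GRing.scale /=; field.
pose H' := mu t * (derive1 xi t / xi t) +
  lam t * (mu t * - (v x * (t - toR c)^-1 + ln (t - toR c) * D v x)).
pose E := expR (mu t * lam t).
have dG : is_derive t 1 (toR \o f \o @to_X R) (derive1 h E * (E * H')).
  apply: near_eq_is_derive G_near _.
  have dE : is_derive t 1 (fun s => expR (mu s * lam s)) (E * H').
    exact: (@is_derive1_comp R expR _ t _ _ (is_derive_expR _) (is_deriveM dmu dlam)).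
  apply: (@is_derive1_comp R h _ t _ _ _ dE); rewrite derive1E; apply: derivableP; exact: hC.1.
have DfE : Df x = derive1 h E * (E * H').
  have dG' := is_derive_to_X t01 (C1_differentiable fC1 (x := to_X t)).
  by rewrite -[RHS](@derive_val _ _ _ _ _ _ _ dG) (@derive_val _ _ _ _ _ _ _ dG') tx.
pose s := - ln (t - toR c).
have es : expR (- s) = t - toR c by rewrite opprK lnK.
have es' : (t - toR c)^-1 = expR s by rewrite -es expRN invrK.
have tc1 : t - toR c <= 1.
  by rewrite lerBlDl (le_trans (ltW xr))// (le_trans rc)// lerDr ltW.
have s0 : 0 <= s by rewrite oppr_ge0 ln_le0.
have xtc : `|t - toR c| <= 1 by rewrite gtr0_norm.
have [xi'k xiLip] := xik t xtc.
have xie : `|xi t| <= expR (-1).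
  move: xiLip; rewrite xic subr0 => /le_trans; apply; apply: le_trans rxi.
  by rewrite ler_pM2l// gtr0_norm// lerBlDl ltW.
have xi_gt0 : 0 < `|xi t| by rewrite normr_gt0.
have xi1 : `|xi t - 0| <= 1.
  by rewrite subr0 (le_trans xie)// -expR0 ler_expR lerNl oppr0.
have xiV : `|xi t|^-1 <= kg * expR s.
  have [_] := gk _ xi1; rewrite g0 xiK subr0 gtr0_norm// => tk.
  rewrite -es' -div1r ler_pdivrMr// mulrAC ler_pdivlMr// mul1r//.
have lam1 : lam t <= -1 by rewrite lamE// -[leRHS]expRK ler_ln ?posrE ?expR_gt0.
have lamV : `|lam t| <= kg * expR s.
  rewrite ler0_norm; last by rewrite (le_trans lam1)// oppr_le0.
  rewrite lamE// -lnV ?posrE//; apply: le_trans xiV.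
  by apply/ltW/ln_sublinear; rewrite invr_gt0.
have vx : v0 <= v x <= v1.
  apply: half_le_double => //.
    apply: near2; rewrite ltr0_norm ?subr_lt0// opprB lerBlDl (le_trans (ltW xr))//.
    by rewrite lerD2l.
have muE : mu t = expR (v x * s) by rewrite /mu tx /s mulrN.
have mu_ge : expR (v0 * s) <= mu t.
  by rewrite muE ler_expR ler_wpM2r//; case/andP: vx.
have mu0 : 0 < mu t by exact: expR_gt0.
have H'le : `|H'| <= C * expR (q * s).
  have -> : H' = expR (v x * s) * (derive1 xi t / xi t) +
      lam t * (expR (v x * s) * - (v x * expR s - s * D v x)).
    by rewrite /H' muE es' /s mulNr opprK.
  by apply: flat_log_derivative vx _ _ _ _ _ => //; exact: ltW.
have E0 : 0 < E by exact: expR_gt0.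
have Eeta : E = eta (toR (f x)) by rewrite /E -eqE ?tx// cx.
have ml0 : mu t * lam t <= - mu t by rewrite -mulrN1 ler_pM2l.
have E1 : `|E - 0| <= 1.
  by rewrite subr0 gtr0_norm// -expR0 ler_expR (le_trans ml0)// oppr_le0 ltW.
have [h'k hLip] := hk E E1.
have fcE : `|toR (f x) - toR (f c)| <= kh * E.
  by move: hLip; rewrite h0 Eeta etaK subr0 -Eeta (gtr0_norm E0).
have f1 : `|toR (f x) - toR (f c)| <= 1 by exact: toR_dist_le1.
have [_ etaLip] := etak _ f1.
have Ef : E <= keta * `|toR (f x) - toR (f c)|.
  by move: etaLip; rewrite etac subr0 -Eeta (gtr0_norm E0).
have f0 : 0 < `|toR (f x) - toR (f c)| by have := lt_le_trans E0 Ef; rewrite pmulr_rgt0//.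
set F := `|toR (f x) - toR (f c)| in fcE f1 Ef f0 *.
have Df0 : 0 < `|Df x|.
  by apply: (D_neq0 Dc) => xc; move: cx; rewrite /t xc ltxx.
have DfF : `|Df x| <= kh * keta * C * F * expR (q * s).
  have -> : kh * keta * C * F * expR (q * s) = kh * ((keta * F) * (C * expR (q * s))) by ring.
  rewrite DfE !normrM; apply: ler_pM; rewrite ?mulr_ge0//.
  by apply: ler_pM; rewrite // (gtr0_norm E0).
have : ln `|Df x| <= ln (kh * keta * C) + ln F + q * s.
  have K0 : 0 < kh * keta * C := mulr_gt0 (mulr_gt0 kh0 keta0) C0.
  have -> : ln (kh * keta * C) + ln F + q * s = ln (kh * keta * C * F * expR (q * s)).
    rewrite [RHS]lnM ?posrE ?expR_gt0//; last exact: mulr_gt0.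
    by rewrite expRK [ln (_ * F)]lnM ?posrE.
  by rewrite ler_ln ?posrE//; exact: mulr_gt0 (mulr_gt0 K0 f0) (expR_gt0 _).
have lnF : ln F <= ln kh - expR (v0 * s).
  apply: (@le_trans _ _ (ln (kh * E))); first by rewrite ler_ln ?posrE ?mulr_gt0.
  by rewrite lnM ?posrE// expRK lerD2l (le_trans ml0)// lerN2.
have := linear_le_exp s q0 w0 v00.
have : w * ln F <= w * (ln kh - expR (v0 * s)) by rewrite ler_pM2l.
rewrite mulrBr mulrBl mul1r.
set u := w * expR _ => *; rewrite addrA; lra.
Qed.

End flatness.

(** * Empirical measures and weak convergence *)

Section empirical_measures.
Variables (R : realType) (f : X R -> X R).
Implicit Types (x : X R) (g : X R -> R).

Lemma ge0_integral_empirical x n (g : X R -> \bar R) : (0 < n)%N ->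
  measurable_fun setT g -> (forall y, (0 <= g y)%E) ->
  (\int[(empirical f x n : probability _ _)]_y g y =
    (n%:R^-1)%:E * \sum_(i < n) g (iter i f x))%E.
Proof.
move=> n0 mg g0; have n0' : 0 <= n%:R^-1 :> R by rewrite invr_ge0.
rewrite (eq_measure_integral (mscale (NngNum n0') (msum (fun i => \d_(iter i f x)) n))).
  rewrite ge0_integral_mscale// ge0_integral_measure_sum//; congr (_ * _)%E.
  by apply: eq_bigr => i _; rewrite integral_dirac// diracT mul1e.
by move=> A mA _; exact: (@empiricalE R f x n A n0).
Qed.

Lemma prob_int_empirical x n g : (0 < n)%N -> bmeas g ->
  \int[(empirical f x n : probability _ _)]_y g y =
    n%:R^-1 * \sum_(i < n) g (iter i f x).
Proof.
move=> n0 mg; have [mg' [B gB]] := mg; set P := (empirical f x n : probability _ _).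
have nR : n%:R != 0 :> R by rewrite pnatr_eq0 -lt0n.
have mgB := bmeasD mg (bmeas_cst _ B).
have gB0 y : 0 <= g y + B.
  by have := gB y; rewrite ler_norml => /andP[gl _]; rewrite -lerBlDr sub0r.
have -> : \int[P]_y g y = \int[P]_y (g y + B) - B.
  by rewrite (prob_intD P mg (bmeas_cst _ B)) prob_int_cst addrK.
have mgB' : measurable_fun setT (fun y => (g y + B)%:E).
  by apply/measurable_EFinP; exact: mgB.1.
have gB0' y : (0 <= (g y + B)%:E)%E by rewrite lee_fin.
rewrite /Rintegral (ge0_integral_empirical x n0 mgB' gB0').
rewrite sumEFin -EFinM /= big_split /= sumr_const card_ord mulrDr.
by rewrite -[B *+ n]mulr_natl mulKf// addrK.
Qed.

Lemma empirical_periodic_invariant x n : (0 < n)%N -> iter n f x = x ->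
  measurable_fun setT f -> invariant_measure f (empirical f x n).
Proof.
move=> n0 xn fm A mA.
have mfA : measurable (f @^-1` A) by rewrite -[_ @^-1` _]setTI; exact: fm.
rewrite (@empiricalE R f x n _ n0) (@empiricalE R f x n A n0); congr (_ * _)%E.
case: n n0 xn => // n _ xn.
rewrite big_ord_recr [RHS]big_ord_recl /= addeC; congr (_ + _)%E.
by rewrite /= !diracE -[in RHS]xn.
Qed.

Lemma lyapunov_empirical x n : class_C 1 setT (toR \o f) -> (0 < n)%N ->
  (forall i, 0 < `|D (toR \o f) (iter i f x)|) ->
  lyapunov f (empirical f x n) =
  (n%:R^-1 * \sum_(i < n) ln `|D (toR \o f) (iter i f x)|)%:E.
Proof.
move=> fC1 n0 D0; have [L L1 [DL _]] := C1_lipschitz fC1.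
pose a := ln L; have a0 : 0 <= a by exact: ln_ge0.
have Da y : `|D (toR \o f) y| <= expR a by rewrite lnK// posrE (lt_le_trans ltr01).
have nR : n%:R != 0 :> R by rewrite pnatr_eq0 -lt0n.
have E : (\int[(empirical f x n : probability _ _)]_y log_defect f a y =
    (a - n%:R^-1 * \sum_(i < n) ln `|D (toR \o f) (iter i f x)|)%:E)%E.
  rewrite (ge0_integral_empirical x n0 (measurable_log_defect fC1 a)); last first.
    by move=> y; exact: log_defect_ge0.
  under eq_bigr => i _ do rewrite /log_defect lne_EFin// -EFinB.
  rewrite sumEFin -EFinM sumrB sumr_const card_ord mulrBr.
  by rewrite -[a *+ n]mulr_natl mulKf.
rewrite (lyapunov_defect fC1 a0 Da); first by rewrite E -EFinB; congr EFin; lra.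
by rewrite E ltry.
Qed.

End empirical_measures.

Section weak_convergence.

Lemma initial_cvgP (S : choiceType) (T : topologicalType) (g : S -> T)
    (F : set_system S) (s : S) : Filter F ->
  (F --> (s : initial_topology g)) <-> (g x @[x --> F] --> g s).
Proof.
move=> FF; split=> [Fs|Fs A].
  by move=> A /(@initial_continuous _ _ g s)/Fs.
by move=> [B [[C oC <-] Cs CA]]; apply: filterS CA _; apply: Fs; apply: open_nbhs_nbhs.
Qed.

Lemma ptws_cvgP (I : Type) (V : topologicalType) (F : set_system {ptws I -> V})
    (phi : {ptws I -> V}) : Filter F ->
  (F --> phi) <-> (forall i, g i @[g --> F] --> phi i).
Proof.
move=> FF; split=> [Fphi i|Fphi].
  by have /cvg_sup/(_ i)/initial_cvgP := Fphi.
by apply/cvg_sup => i; apply/initial_cvgP; exact: Fphi.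
Qed.

Lemma weak_cvgP (R : realType) (nu : nat -> M R) (mu : M R) :
  (nu i @[i --> \oo] --> mu) <->
  (forall g : continuousType (X R) R,
    \int[(nu i : probability _ _)]_x g x @[i --> \oo] -->
    \int[(mu : probability _ _)]_x g x).
Proof.
split=> [/initial_cvgP/ptws_cvgP numu g|numu]; first exact: numu.
by apply/initial_cvgP/ptws_cvgP => g; exact: numu.
Qed.

End weak_convergence.

(** * The rate function at a post-critical measure *)

Section averages.
Variable R : realType.

Lemma count_late m N j : \sum_(i < j) ((m < i.+1 + N)%:R : R) <= (j + N - m)%:R.
Proof.
elim: j => [|j IHj]; first by rewrite big_ord0.
by rewrite big_ord_recr /= addSn subSn_lt natrD lerD2r.
Qed.

Lemma sums_close (a b : nat -> R) (B e : R) m N N' : 0 <= B -> 0 <= e ->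
  (forall i, `|a i| <= B) -> (forall i, `|b i| <= B) ->
  (forall i, (i + N' <= m)%N -> `|a i - b i| <= e) ->
  `|\sum_(i < m + N) a i - \sum_(i < m) b i| <= m%:R * e + (N'%:R * (2 * B) + N%:R * B).
Proof.
move=> B0 e0 aB bB ab.
rewrite big_split_ord /= addrAC -sumrB.
apply: le_trans (ler_normD _ _) _; rewrite addrA; apply: lerD; last first.
  apply: le_trans (ler_norm_sum _ _ _) _.
  have -> : N%:R * B = \sum_(i < N) B by rewrite sumr_const card_ord mulr_natl.
  by apply: ler_sum => i _.
apply: le_trans (ler_norm_sum _ _ _) _.
apply: (@le_trans _ _ (\sum_(i < m) (e + (m < i.+1 + N')%:R * (2 * B)))).
  apply: ler_sum => i _; case: ltnP => im; last first.
    by rewrite mul0r addr0 ab// ltnW.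
  rewrite mul1r (le_trans (ler_normB _ _))// mulr_natl mulr2n.
  by rewrite -[leLHS]add0r lerD// lerD.
rewrite big_split /= sumr_const card_ord -[e *+ m]mulr_natl lerD2l -mulr_suml.
rewrite ler_wpM2r ?mulr_ge0//; apply: le_trans (count_late m N' m) _.
by rewrite addKn.
Qed.

Lemma averages_close (a b : nat -> R) (B e : R) m N N' : (0 < m)%N -> 0 <= B -> 0 <= e ->
  (forall i, `|a i| <= B) -> (forall i, `|b i| <= B) ->
  (forall i, (i + N' <= m)%N -> `|a i - b i| <= e) ->
  `|(m + N)%:R^-1 * \sum_(i < m + N) a i - m%:R^-1 * \sum_(i < m) b i| <=
    e + 2 * (N'%:R + N%:R) * B / m%:R.
Proof.
move=> m0 B0 e0 aB bB ab; have := sums_close N B0 e0 aB bB ab.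
set A := \sum_(i < m + N) _; set A' := \sum_(i < m) _ => AA'.
have mR : 0 < m%:R :> R by rewrite ltr0n.
have nR : 0 < (m + N)%:R :> R by rewrite ltr0n ltn_addr.
have AB : `|A| <= (m + N)%:R * B.
  apply: le_trans (ler_norm_sum _ _ _) _.
  have -> : (m + N)%:R * B = \sum_(i < m + N) B by rewrite sumr_const card_ord mulr_natl.
  by apply: ler_sum.
have -> : (m + N)%:R^-1 * A - m%:R^-1 * A' =
    m%:R^-1 * ((A - A') - (m + N)%:R^-1 * A * N%:R).
  by rewrite natrD; field; rewrite -natrD !gt_eqF.
have AN : `|(m + N)%:R^-1 * A * N%:R| <= N%:R * B.
  rewrite mulrC normrM ger0_norm// ler_wpM2l// normrM gtr0_norm ?invr_gt0//.
  by rewrite ler_pdivrMl.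
rewrite normrM gtr0_norm ?invr_gt0// ler_pdivrMl//.
apply: le_trans (ler_normB _ _) _; apply: le_trans (lerD AA' AN) _.
rewrite mulrDr [m%:R * (_ / _)]mulrC divfK ?gt_eqF//.
have -> : m%:R * e + (N'%:R * (2 * B) + N%:R * B) + N%:R * B =
  m%:R * e + 2 * (N'%:R + N%:R) * B by ring.
by [].
Qed.

Lemma cvg_div_infty (C : R) (m : nat -> nat) : (forall i, (i <= m i)%N) ->
  forall e : R, 0 < e -> \forall i \near \oo, C / (m i)%:R <= e.
Proof.
move=> mi e e0; exists (Num.truncn (`|C| / e)).+1 => // i /= Ci.
have im : (Num.truncn (`|C| / e)).+1%:R <= (m i)%:R :> R by rewrite ler_nat (leq_trans Ci).
have C_e : `|C| / e < (m i)%:R by apply: lt_le_trans im; exact: truncnS_gt.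
have m0 : 0 < (m i)%:R :> R by apply: le_lt_trans C_e; rewrite divr_ge0// ltW.
rewrite ler_pdivrMr// (le_trans (ler_norm C))// mulrC -ler_pdivrMr//.
exact: ltW.
Qed.

End averages.

Theorem theoremB (R : realType) (f : X R -> X R) (c : X R) (ell : X R -> R)
    (mu : M R) :
  topologically_exact f ->
  S_unimodal f c ->
  non_recurrent f c ->
  flat f c ->
  flat_exponent f c ell ->
  polynomial_order c ell ->
  invariant_measure f mu ->
  post_critical f c mu ->
  rate f mu = 0%E.
Proof.
move=> fex [[fC1 c01 Dc _] _ _] cnr _ fflat fpol _ [m [m_inc m0 c_mu]].
have fc := C1_continuous fC1; have fm := continuous_measurable_map fc.
have [N [p [pper pc pD psum]]] :=
  slow_periodic_orbits fC1 fex cnr Dc c01 (flat_derivative fC1 Dc c01 fflat fpol).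
have im i : (i <= m i)%N.
  elim: i => [//|i IHi]; apply: leq_ltn_trans IHi _; exact: m_inc.
pose n i := (m i + N)%N; have n0 i : (0 < n i)%N by rewrite ltn_addr.
have in_ i : (i <= n i)%N by rewrite (leq_trans (im i))// leq_addr.
pose nu i : M R := empirical f (p (m i)) (n i).
have nuinv i : invariant_measure f (nu i).
  by apply: empirical_periodic_invariant => //; exact: pper.
have nu_mu : nu i @[i --> \oo] --> mu.
  apply/weak_cvgP => g; have gc : continuous g by exact: cts_fun.
  have [B B0 gB] := X_bounded gc; have gm := continuous_bmeas gc.
  apply/cvgrPdist_le => e e0; have e30 : 0 < e / 3 by rewrite divr_gt0.
  have [d d0 gd] := X_unif_continuous gc e30.
  (* uniform continuity of the test function turns shadowing into closeness of
     the time averages *)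
  have [N' HN'] := pc d d0.
  have /weak_cvgP/(_ g)/cvgrPdist_le/(_ _ e30) := c_mu.
  move=> near_mu.
  have := cvg_div_infty (2 * (N'%:R + N%:R) * B) im e30.
  apply: filterS2 near_mu => i; rewrite !prob_int_empirical// => near_mu Ci.
  have := @averages_close R (fun j => g (iter j f (p (m i)))) (fun j => g (iter j f c))
    B (e / 3) (m i) N N' (m0 i) (ltW B0) (ltW e30) _ _ _.
  have close j : (j + N' <= m i)%N -> `|g (iter j f (p (m i))) - g (iter j f c)| <= e / 3.
    by move=> jm; apply: gd; rewrite distrC ltW// HN'.
  move=> /(_ (fun=> gB _) (fun=> gB _) close) near_c.
  have := ler_distD ((m i)%:R^-1 * \sum_(j < m i) g (iter j f c))
    (\int[(mu : probability _ _)]_x g x) ((n i)%:R^-1 * \sum_(j < n i) g (iter j f (p (m i)))).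
  rewrite (distrC (_ * _) (_ * _)); move: near_mu near_c Ci; rewrite -/(n i).
  move: (`|_|) (`|_|) (`|_|) => x y z; lra.
rewrite /rate; apply/eqP; rewrite eqe_oppLR oppe0 eq_le; apply/andP; split.
  apply: (@le_trans _ _ (ereal_sup (free_energy f @` setT))).
    apply: ereal_inf_lbound; exists setT => //; split=> //; exact: openT.
  apply: ge_ereal_sup => _ [nu' _ <-].
  rewrite /free_energy; case: asboolP => // nu'inv.
  by have := free_energy_le0 fC1 fex nu'inv; rewrite /free_energy asboolT.
apply: le_ereal_inf_tmp => _ [G [oG Gmu] <-].
apply/lee_addgt0Pr => e e0; have e20 : 0 < e / 2 by rewrite divr_gt0.
have [C HC] := psum _ e20.
have nuG : \forall i \near \oo, G (nu i) by apply: nu_mu; exact: open_nbhs_nbhs.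
have [i [Gi Ci]] : exists i, G (nu i) /\ C / (n i)%:R <= e / 2.
  by apply: (@filter_ex _ \oo); apply: filterI nuG _; exact: cvg_div_infty.
have : (free_energy f (nu i) <= ereal_sup (free_energy f @` G))%E.
  by apply: ereal_sup_ubound; exists (nu i).
move=> /(leeD2r e%:E); apply: le_trans.
rewrite /free_energy asboolT//.
rewrite (lyapunov_empirical fC1 (n0 i)); last by move=> j; exact: pD.
have := HC (m i) (m0 i); rewrite -/(n i) => hsum.
have nR : 0 < (n i)%:R :> R by rewrite ltr0n.
have le_e : (n i)%:R^-1 * \sum_(j < n i) ln `|D (toR \o f) (iter j f (p (m i)))| <= e.
  rewrite ler_pdivrMl// (le_trans hsum)//.
  by move: Ci; rewrite ler_pdivrMr//; lra.
have h0 := entropy_ge0 fC1 (nu i).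
by rewrite -addeA -EFinN -EFinD; apply: adde_ge0 => //; rewrite lee_fin addrC subr_ge0.
Qed.
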